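(* For $P\in\mathcal{P}_0^n$ consider the inequalities (valid for all $P\in\mathcal{P}^n_0$) $$\text{(M)}\quad \left(\prod_{i=1}^n\frac{\lambda_i(P)}{2}\right)^{1/n}\le\left(\prod_{i=1}^n\gamma_i(P)\right)^{1/n}\le n!^{1/n}\left(\prod_{i=1}^n\frac{\lambda_i(P)}{2}\right)^{1/n}$$ and $$\text{(A)}\quad \frac1n\left(\sum_{i=1}^n\gamma_i(P)\right)\le\frac1n\left(\sum_{i=1}^n\frac{\lambda_i(P)}{2}\right).$$ (i) There exist lattice polytopes $P\in\mathcal{P}_0^n$ with equality in (A) and equality in the upper bound, or in the lower bound, or in none of the inequalities of (M) (that is, each of these three cases occurs). (ii) There exist lattice polytopes $P\in\mathcal{P}_0^n$ with strict inequality in (A) and equality in the upper bound, or in the lower bound, or in none of the inequalities of (M) (that is, each of these three cases occurs).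
   Context: A lattice $n$-polytope is a convex polytope $P\subset\mathbb{R}^n$ with $\dim P=n$ all of whose vertices lie in $\mathbb{Z}^n$; $\mathcal{P}_0^n$ is the set of those that are $0$-symmetric ($P=-P$). The Ehrhart polynomial of $P$ is the unique polynomial $\mathrm{G}(s,P)=\sum_{i=0}^n \mathrm{G}_i(P)s^i$ with $\mathrm{G}(k,P)=\#(kP\cap\mathbb{Z}^n)$ for all positive integers $k$; it has degree $n$, constant term $1$ and leading coefficient $\mathrm{vol}(P)$. It is regarded as a polynomial in $s\in\mathbb{C}$ and factored as $\mathrm{G}(s,P)=\prod_{i=1}^n\left(1+\frac{s}{\gamma_i(P)}\right)$, so its roots with multiplicity are $-\gamma_1(P),\dots,-\gamma_n(P)$. In particular $\prod_i\gamma_i(P)=1/\mathrm{vol}(P)>0$ and $\sum_i\gamma_i(P)$ is real. For a $0$-symmetric convex body $K\subset\mathbb{R}^n$ with non-empty interior, the $i$-th successive minimum is $\lambda_i(K)=\min\{\lambda>0:\dim(\lambda K\cap\mathbb{Z}^n)\ge i\}$, where $\dim$ of a set of lattice points means the dimension of its linear span.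
   Formalization: The dimension is restricted to n ≥ 2, and all six cases are shown for every such n; for n = 1 each P = [-m,m] gives equality in (A) and in both bounds of (M), so (ii) and the case ''none'' of (i) fail there. *)

(* Defs.v *)
From HB Require Import structures.
From mathcomp Require Import all_boot all_order all_algebra.
From mathcomp Require Import finmap.
From mathcomp Require Import boolp classical_sets functions cardinality reals.
From mathcomp Require Import complex.

Set Implicit Arguments.
Unset Strict Implicit.
Unset Printing Implicit Defensive.

Import Order.TTheory GRing.Theory Num.Theory.

Local Open Scope classical_set_scope.
Local Open Scope ring_scope.
Local Open Scope complex_scope.

Section LatticePolytopes.
Variables (R : realType) (n : nat).
Implicit Types (A P K : set 'rV[R]_n).

Definition int_lattice : set 'rV[R]_n := [set x | forall j, x 0 j \is a Num.int].

Definition dilate (l : R) K : set 'rV[R]_n := [set l *: x | x in K].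

Definition conv_hull (V : seq 'rV[R]_n) : set 'rV[R]_n :=
  [set x | exists w : 'I_(size V) -> R,
     [/\ forall i, 0 <= w i, \sum_i w i = 1 & x = \sum_i w i *: V`_i]].

Definition polytope P := exists V : seq 'rV[R]_n, P = conv_hull V.

(* Vertices are the extreme points. *)
Definition vertex P (v : 'rV[R]_n) :=
  P v /\ forall x y (t : R), P x -> P y -> 0 < t < 1 ->
           v = t *: x + (1 - t) *: y -> x = y.

(* The smallest subspace containing A; it always exists (lin_span_exists), so
   the default value 0 is never returned. *)
Definition lin_span A : {vspace 'rV[R]_n} :=
  xget 0%VS [set U : {vspace 'rV[R]_n} |
    (forall x, A x -> x \in U) /\
    (forall W : {vspace 'rV[R]_n}, (forall x, A x -> x \in W) -> (U <= W)%VS)].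

(* The dimension of the affine hull of P: its direction is the linear span of
   P - P. *)
Definition aff_dim P : nat :=
  \dim (lin_span [set z | exists x y, [/\ P x, P y & z = x - y]]).

Definition lattice_polytope P :=
  [/\ polytope P, aff_dim P = n & forall v, vertex P v -> int_lattice v].

Definition symmetric_lattice_polytope P :=
  lattice_polytope P /\ P = [set - x | x in P].

Definition lattice_points (k : nat) P : nat :=
  #|` fset_set (dilate k%:R P `&` int_lattice)|.

(* The polynomial is unique since a polynomial is determined by its values at
   the positive integers; it exists when P is a lattice polytope. *)
Definition ehrhart P : {poly R} :=
  xget 0 [set G : {poly R} |
    forall k : nat, (0 < k)%N -> G.[k%:R] = (lattice_points k P)%:R].

(* The family (gamma_i)_i with G(s, P) = \prod_i (1 + s / gamma_i); it is only
   determined up to the order of its entries. *)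
Definition ehrhart_gamma P : {ffun 'I_n -> R[i]} :=
  xget [ffun=> 0] [set g : {ffun 'I_n -> R[i]} |
    (forall i, g i != 0) /\
    map_poly (real_complex R) (ehrhart P) = \prod_i (1 + (g i)^-1 *: 'X)].

Definition minimum (S : set R) : R := xget 0 (S `&` lbound S).

Definition succ_min (i : nat) K : R :=
  minimum [set l : R |
    0 < l /\ (i <= \dim (lin_span (dilate l K `&` int_lattice)))%N].

(* All quantities compared below live in R[i], where x <= y means that y - x
   is a nonnegative real; on nonnegative reals [n.-root] (n > 0) is the real
   n-th root. *)
Definition geom_mean_gamma P : R[i] := n.-root (\prod_i ehrhart_gamma P i).

(* Indices of 'I_n start at 0, hence the shift. *)
Definition geom_mean_minima P : R[i] :=
  n.-root (\prod_(i < n) (succ_min i.+1 P / 2))%:C.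

Definition arith_mean_gamma P : R[i] := n%:R^-1 * \sum_i ehrhart_gamma P i.

Definition arith_mean_minima P : R[i] :=
  (n%:R^-1 * \sum_(i < n) (succ_min i.+1 P / 2))%:C.

Definition M_lower_eq P := geom_mean_minima P = geom_mean_gamma P.

Definition M_upper_eq P :=
  geom_mean_gamma P = n.-root (n`!%:R) * geom_mean_minima P.

Definition M_strict P :=
  geom_mean_minima P < geom_mean_gamma P /\
  geom_mean_gamma P < n.-root (n`!%:R) * geom_mean_minima P.

Definition A_eq P := arith_mean_gamma P = arith_mean_minima P.

Definition A_strict P : Prop := arith_mean_gamma P < arith_mean_minima P.

Lemma lin_span_exists A : exists U : {vspace 'rV[R]_n},
  (forall x, A x -> x \in U) /\
  (forall W : {vspace 'rV[R]_n}, (forall x, A x -> x \in W) -> (U <= W)%VS).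
Proof.
pose p d := `[< exists X : seq 'rV[R]_n,
                 (forall x, x \in X -> A x) /\ \dim <<X>>%VS = d >].
have p0 : exists d, p d.
  by exists 0%N; apply/asboolP; exists [::]; rewrite span_nil dimv0.
have pn d : p d -> (d <= \dim {: 'rV[R]_n})%N.
  by move=> /asboolP[X [_ <-]]; apply/dimvS/subvf.
have [d /asboolP[X [XA dX]] dmax] := ex_maxnP p0 pn.
exists <<X>>%VS; split=> [x Ax|W AW]; last by apply/span_subvP => x /XA/AW.
have sXx : (<<X>> <= <<x :: X>>)%VS by apply: sub_span => y; rewrite inE orbC => ->.
have : (\dim <<x :: X>> <= \dim <<X>>)%N.
  rewrite dX; apply: dmax; apply/asboolP; exists (x :: X); split=> // y.
  by rewrite inE => /orP[/eqP ->//|/XA].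
rewrite (geq_leqif (dimv_leqif_sup sXx)) => /subvP; apply.
exact/memv_span/mem_head.
Qed.

End LatticePolytopes.

(* Main.v *)
Require Import Defs.
From mathcomp Require Import all_boot all_order all_algebra.
From mathcomp Require Import finmap.
From mathcomp Require Import boolp classical_sets functions cardinality reals.
From mathcomp Require Import complex.
From mathcomp Require Import zify ring lra.

Set Implicit Arguments.
Unset Strict Implicit.
Unset Printing Implicit Defensive.

Import Order.TTheory GRing.Theory Num.Theory.

Local Open Scope classical_set_scope.
Local Open Scope ring_scope.
Local Open Scope complex_scope.

(** By uniqueness of the Ehrhart polynomial [G], one has
    [\prod gamma_i = 1 / G_n] and [\sum gamma_i = G_(n-1) / G_n], so each
    example only requires its Ehrhart polynomial and its successive minima.

    Equality in the upper bound of (M) is attained by the cross-polytopes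
    [conv (+-a e_1, +-e_2, ..., +-e_n)], for which [G_(n-1) / G_n = n / (2 a)]:
    (A) is an equality for [a = 1] and strict for [a = 2].

    The other examples are products of a planar polygon [Q] with the cube
    [[-a, a]^(n-2)], all of whose successive minima are [1 / a]. Such a product
    multiplies [G] by [(2 a s + 1)^(n-2)], hence [\prod (2 gamma_i / lambda_i)]
    and [\sum (gamma_i - lambda_i / 2)] are those of [Q]. The square gives equality
    in both (A) and the lower bound of (M). The parallelogram with [a = 2] and
    [G = 16 s^2 + 6 s + 1], a sheared square that tiles the plane by translations
    in [4 Z^2], gives equality in the lower bound and a strict (A). The hexagon
    obtained from [[-a, a]^2] by cutting off two opposite unit corners has
    [G = (4 a^2 - 1) s^2 + (4 a - 1) s + 1]; both inequalities of (M) are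
    strict, and (A) is an equality for [a = 1] and strict for [a = 2]. *)

(** * Convex hulls and spans *)

Lemma conv_hull_comb (R : realType) n (V : seq 'rV[R]_n) (I : finType)
    (w : I -> R) (x : I -> 'rV[R]_n) :
  (forall i, 0 <= w i) -> \sum_i w i = 1 -> (forall i, conv_hull V (x i)) ->
  conv_hull V (\sum_i w i *: x i).
Proof.
move=> w0 w1 /choice[u uP]; exists (fun j => \sum_i w i * u i j); split.
- by move=> j; apply: sumr_ge0 => i _; apply: mulr_ge0 => //; case: (uP i).
- rewrite exchange_big /= -[RHS]w1; apply: eq_bigr => i _.
  by case: (uP i) => _ u1 _; rewrite -mulr_sumr u1 mulr1.
- under [RHS]eq_bigr => j _ do rewrite scaler_suml.
  rewrite exchange_big /=; apply: eq_bigr => i _.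
  case: (uP i) => _ _ ->; rewrite scaler_sumr.
  by apply: eq_bigr => j _; rewrite scalerA.
Qed.

Lemma conv_hull_mem (R : realType) n (V : seq 'rV[R]_n) v :
  v \in V -> conv_hull V v.
Proof.
move=> vV; have iV : (index v V < size V)%N by rewrite index_mem.
exists (fun j => (j == Ordinal iV)%:R); split.
- by move=> j; rewrite ler0n.
- by rewrite (bigD1 (Ordinal iV)) //= eqxx big1 ?addr0 // => j /negPf ->.
- rewrite (bigD1 (Ordinal iV)) //= eqxx scale1r nth_index // big1 ?addr0 //.
  by move=> j /negPf ->; rewrite scale0r.
Qed.

Lemma conv_hull_segment (R : realType) n (V : seq 'rV[R]_n) x y t :
  0 <= t <= 1 -> conv_hull V x -> conv_hull V y ->
  conv_hull V (t *: x + (1 - t) *: y).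
Proof.
move=> /andP[t0 t1] Vx Vy.
have := @conv_hull_comb R n V bool (fun b => if b then t else 1 - t)
  (fun b => if b then x else y); rewrite !big_bool /=; apply.
- by case=> //; rewrite subr_ge0.
- by rewrite addrC subrK.
- by case.
Qed.

(** By Jensen's inequality a sublinear bound need only be checked on the generators. Applied to
    absolute values of linear forms and to a gauge, it puts a hull inside the body cut out by the
    corresponding inequalities. *)
Lemma conv_hull_sublinear (R : realType) n (V : seq 'rV[R]_n)
    (f : 'rV[R]_n -> R) c x :
  (forall y z, f (y + z) <= f y + f z) ->
  (forall l y, 0 <= l -> f (l *: y) = l * f y) ->
  {in V, forall v, f v <= c} -> conv_hull V x -> f x <= c.
Proof.
move=> fD fZ fV [w [w0 w1 ->]].
have f0 : f 0 = 0 by rewrite -[0 in LHS](scale0r (0 : 'rV[R]_n)) fZ ?mul0r.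
apply: (@le_trans _ _ (\sum_i w i * f V`_i)).
  apply: (big_ind2 (fun a b => f a <= b)); first by rewrite f0.
    by move=> y a z b ya zb; apply: le_trans (fD _ _) _; apply: lerD.
  by move=> i _; rewrite fZ.
rewrite -[leRHS]mul1r -w1 mulr_suml; apply: ler_sum => i _.
by apply: ler_wpM2l => //; apply/fV/mem_nth.
Qed.

(** Pick a generator of positive weight. If the weight is 1, the generator is the point itself;
    otherwise the point lies strictly inside a segment ending at this generator, and extremality
    collapses the segment. *)
Lemma conv_hull_vertex (R : realType) n (V : seq 'rV[R]_n) v :
  vertex (conv_hull V) v -> v \in V.
Proof.
move=> [[w [w0 w1 vE]] vext].
have [i wi] : exists i, w i != 0.
  apply/existsP; apply: contraT; rewrite negb_exists => /forallP w00.
  move: w1; rewrite big1; first by move=> /esym/eqP; rewrite oner_eq0.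
  by move=> i _; apply/eqP; move: (w00 i); rewrite negbK.
have wi_gt0 : 0 < w i by rewrite lt_def wi w0.
have sum' : \sum_(j | j != i) w j = 1 - w i.
  by rewrite -w1 [in RHS](bigD1 i) //= addrAC subrr add0r.
have wi_le1 : w i <= 1 by rewrite -subr_ge0 -sum' sumr_ge0.
have Vi : V`_i \in V by apply: mem_nth.
move: wi_le1; rewrite le_eqVlt => /orP[/eqP wi1|wi_lt1].
  have w00 j : j != i -> w j = 0.
    move: sum'; rewrite wi1 subrr => /eqP; rewrite psumr_eq0 // => /allP h ji.
    by apply/eqP; move: (h j (mem_index_enum _)); rewrite ji.
  suff -> : v = V`_i by [].
  rewrite vE (bigD1 i) //= wi1 scale1r big1 ?addr0 // => j /w00 ->.
  by rewrite scale0r.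
have c_gt0 : 0 < 1 - w i by rewrite subr_gt0.
(* The barycentre of the remaining generators, with weights rescaled to sum to 1. *)
pose y := \sum_j (if j == i then 0 else w j / (1 - w i)) *: V`_j.
have yV : conv_hull V y.
  exists (fun j => if j == i then 0 else w j / (1 - w i)); split=> //.
    by move=> j; case: eqP => // _; apply/divr_ge0/ltW.
  rewrite (bigD1 i) //= eqxx add0r.
  under eq_bigr => j /negPf -> do [].
  by rewrite -mulr_suml sum' divff // gt_eqF.
have vy : v = w i *: V`_i + (1 - w i) *: y.
  rewrite vE (bigD1 i) //= /y [in RHS](bigD1 i) //= eqxx scale0r add0r.
  rewrite scaler_sumr; congr (_ + _); apply: eq_bigr => j /negPf ->.
  by rewrite scalerA mulrC divfK // gt_eqF.
have e : V`_i = y.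
  by apply: (vext _ _ (w i)) => //; [exact: conv_hull_mem | apply/andP].
by rewrite vy -e -scalerDl addrC subrK scale1r.
Qed.

Lemma lin_spanP (R : realType) n (A : set 'rV[R]_n) :
  (forall x, A x -> x \in lin_span A) /\
  (forall W : {vspace 'rV[R]_n}, (forall x, A x -> x \in W) ->
     (lin_span A <= W)%VS).
Proof. exact: (xgetPex 0%VS (lin_span_exists A)). Qed.

Lemma dim_lin_span_le (R : realType) n (A : set 'rV[R]_n)
    (W : {vspace 'rV[R]_n}) :
  (forall x, A x -> x \in W) -> (\dim (lin_span A) <= \dim W)%N.
Proof. by move=> AW; apply/dimvS; apply: (lin_spanP A).2. Qed.

Lemma dim_lin_span_full (R : realType) n (A : set 'rV[R]_n) :
  (forall j, exists2 c, c != 0 & A (c *: 'e_j)) -> \dim (lin_span A) = n.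
Proof.
move=> Ae; suff -> : lin_span A = fullv by rewrite dimvf dim_matrix; exact: mul1n.
apply/eqP; rewrite eqEsubv subvf /=; apply/subvP => x _.
rewrite (row_sum_delta x); apply: memv_suml => j _.
have [c c0 /(lin_spanP A).1 cA] := Ae j.
by rewrite -(mulfVK c0 (x 0 j)) -scalerA memvZ.
Qed.

Lemma minimum_eq (R : realType) (S : set R) m :
  S m -> lbound S m -> minimum S = m.
Proof.
move=> Sm mS; rewrite /minimum.
have [Sx xS] := xgetPex 0 (ex_intro (S `&` lbound S) m (conj Sm mS)).
by apply/eqP; rewrite eq_le xS //= mS.
Qed.

(** * Uniqueness of the Ehrhart polynomial and its roots *)

Lemma ehrhart_eq (R : realType) n (P : set 'rV[R]_n) p :
  (forall k, (0 < k)%N -> p.[k%:R] = (lattice_points k P)%:R) ->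
  ehrhart P = p.
Proof.
move=> pP; have := xgetPex 0 (ex_intro (fun G : {poly R} => forall k : nat,
  (0 < k)%N -> G.[k%:R] = (lattice_points k P)%:R) p pP).
rewrite -/(ehrhart P) => qP; apply/eqP; rewrite -subr_eq0; apply: contraT => d0.
(* The points [1, ..., d], with [d] the size of the difference, would be [d] roots of a nonzero
   polynomial of degree less than [d]. *)
pose rs := [seq (k.+1)%:R : R | k <- iota 0 (size (ehrhart P - p))].
have : (size rs < size (ehrhart P - p)%R)%N.
  apply: max_poly_roots => //.
    apply/allP => _ /mapP[k _ ->].
    by rewrite rootE hornerD hornerN qP // pP // subrr.
  by rewrite map_inj_uniq ?iota_uniq // => i j /eqP; rewrite eqr_nat => /eqP[].
by rewrite size_map size_iota ltnn.
Qed.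

Lemma addZX_XsubC (F : fieldType) (z : F) : z != 0 ->
  1 + z^-1 *: 'X = z^-1 *: ('X - (- z)%:P).
Proof.
move=> z0; rewrite polyCN opprK scalerDr addrC; congr (_ + _).
by rewrite -[z%:P]alg_polyC scalerA mulVf // scale1r.
Qed.

(* With p = \prod_i (1 + s / g i), [p`_n = \prod_i (g i)^-1]; multiplying by
   ['X] turns the coefficient of index [n - 1] into one of index [n], which
   also makes sense for [n = 0]. *)
Lemma ehrhart_gammaP (R : realType) n (P : set 'rV[R]_n) (p : {poly R}) v r :
  ehrhart P = p -> size p = n.+1 -> p`_0 = 1 -> p`_n = v ->
  ('X * p)`_n = v * r ->
  \prod_i ehrhart_gamma P i = (v^-1)%:C /\ \sum_i ehrhart_gamma P i = r%:C.
Proof.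
move=> Pp sp p0 pn pn1.
pose q := map_poly (real_complex R) p.
have sq : size q = n.+1 by rewrite size_map_poly.
have v0 : v != 0.
  by rewrite -pn -[n]/(n.+1.-1) -sp -lead_coefE lead_coef_eq0 -size_poly_eq0 sp.
have vC0 : v%:C != 0 by rewrite fmorph_eq0.
have [rs qE] := closed_field_poly_normal q.
have lq : lead_coef q = v%:C.
  by rewrite lead_coefE sq coef_map pn.
have srs : size rs = n.
  by move: sq; rewrite qE size_scale ?lq // size_prod_XsubC => -[].
have rs0 : \prod_(z <- rs) (- z) = (v%:C)^-1.
  have : q`_0 = 1 by rewrite coef_map p0.
  rewrite qE lq -horner_coef0 hornerZ horner_prod.
  under eq_bigr => z _ do rewrite hornerXsubC sub0r.
  by move=> h; rewrite -[LHS](mulKf vC0) h mulr1.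
(* A factorization exists, so [xget] does not fall back on its default value: the [gamma_i] are the
   negated roots, which are nonzero because their product is [1 / v]. *)
have ex : exists g : {ffun 'I_n -> R[i]}, (forall i, g i != 0) /\
    map_poly (real_complex R) (ehrhart P) = \prod_i (1 + (g i)^-1 *: 'X).
  exists [ffun i : 'I_n => - rs`_i].
  have gp : \prod_(i < n) (- rs`_i) = (v%:C)^-1.
    by rewrite -rs0 (big_nth 0) srs big_mkord.
  have gi0 (i : 'I_n) : - rs`_i != 0.
    have : (v%:C)^-1 != 0 by rewrite invr_eq0.
    by rewrite -gp (bigD1 i) //= mulf_eq0 negb_or => /andP[].
  split=> [i|]; first by rewrite ffunE.
  rewrite Pp -/q qE lq (big_nth 0) srs big_mkord.
  have -> : v%:C = \prod_(i < n) (- rs`_i)^-1 by rewrite prodfV gp invrK.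
  rewrite -scaler_prod; apply: eq_bigr => i _.
  by rewrite ffunE addZX_XsubC // opprK.
(* Only the factorization is known of the chosen family; its product and its sum are read off from
   the top two coefficients. *)
have [g0 gE] := xgetPex [ffun=> 0] ex.
move: g0 gE; rewrite -/(ehrhart_gamma P); set g := ehrhart_gamma P => g0 gE.
pose gs := [seq - g i | i <- index_enum 'I_n].
have sgs : size gs = n.
  by rewrite size_map -[index_enum _]enumT size_enum_ord.
have qE' : q = (\prod_i (g i)^-1) *: \prod_(z <- gs) ('X - z%:P).
  rewrite /q -Pp gE big_map -scaler_prod; apply: eq_bigr => i _.
  by rewrite addZX_XsubC.
have gv : \prod_i (g i)^-1 = v%:C.
  rewrite -lq qE' lead_coefZ.
  by rewrite (monicP (monic_prod_XsubC _ _ _)) mulr1.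
have prodg : \prod_i g i = (v^-1)%:C.
  have -> : (v^-1)%:C = (v%:C)^-1 by exact: (fmorphV (real_complex R)).
  by apply: invr_inj; rewrite invrK -prodfV.
split=> //.
have qn1 : ('X * q)`_n = v%:C * r%:C.
  by rewrite -rmorphM -pn1 -(map_polyX (real_complex R)) -rmorphM coef_map.
apply: (mulfI vC0); rewrite -qn1 {}qE' gv -scalerAr coefZ; congr (_ * _).
(* The formula for the subleading coefficient needs at least one root; for [n = 0] both sides are
   0. *)
case: n => [|n] in P p g rs q gs sgs 
  {Pp sp p0 pn pn1 sq qE lq srs rs0 ex g0 gE gv prodg qn1} *.
  by rewrite coefXM big_ord0.
have := @coefPn_prod_XsubC _ gs; rewrite sgs coefXM /= => -> //.
by rewrite big_map -sumrN; apply: eq_bigr => i _; rewrite opprK.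
Qed.

(** * Lattice point counts and the criteria for (A) and (M) *)

(** [fset_set] is empty on infinite sets; an explicit duplicate-free enumeration certifies
    finiteness and cardinality together. *)
Definition counts (T : eqType) (S : set T) (c : nat) :=
  exists s : seq T, [/\ uniq s, forall x, S x <-> x \in s & size s = c].

Lemma counts_card (T : choiceType) (S : set T) c :
  counts S c -> #|` fset_set S| = c.
Proof.
move=> [s [us Ss <-]]; have -> : S = [set` [fset x in s]%fset].
  by apply/seteqP; split=> x /=; rewrite inE Ss.
by rewrite set_fsetK card_fseq undup_id.
Qed.

Lemma counts_iff (T : eqType) (S S' : set T) c :
  (forall x, S x <-> S' x) -> counts S c -> counts S' c.
Proof.
by move=> SS' [s [us Ss sc]]; exists s; split=> // x; rewrite -SS'.
Qed.

Lemma dilateE (R : realType) n (P : set 'rV[R]_n) l x :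
  l != 0 -> dilate l P x <-> P (l^-1 *: x).
Proof.
move=> l0; split=> [[y Py <-]|Px]; first by rewrite scalerA mulVf // scale1r.
by exists (l^-1 *: x) => //; rewrite scalerA mulfV // scale1r.
Qed.

(* [v] is the volume of [P] and [r] the sum of the [gamma_i]. *)
Record ehrhart_data (R : realType) n (P : set 'rV[R]_n) (v r : R) : Prop :=
  EhrhartData {
    ed_hull : exists2 V : seq 'rV[R]_n,
      {in V, forall x, int_lattice x} & P = conv_hull V;
    ed_sym : forall x, P x -> P (- x);
    ed_axis : forall j, exists2 c, c != 0 & P (c *: 'e_j);
    ed_pos : 0 < v;
    ed_poly : exists p : {poly R},
      [/\ size p = n.+1, p`_0 = 1, p`_n = v, ('X * p)`_n = v * r &
        forall k, (0 < k)%N ->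
          exists2 c, counts (dilate k%:R P `&` @int_lattice R n) c &
                     p.[k%:R] = c%:R] }.

(** Extreme points of the hull are among its integral generators, and the differences of the points
    [+-c e_j] span the whole space. *)
Lemma ehrhart_data_symmetric (R : realType) n (P : set 'rV[R]_n) v r :
  ehrhart_data P v r -> symmetric_lattice_polytope P.
Proof.
case=> [[V Vint PV] Psym Paxis _ _]; split; last first.
  apply/seteqP; split=> x; last by move=> [y /Psym Py <-].
  by move=> /Psym Px; exists (- x) => //; rewrite opprK.
split; first by exists V.
  apply: dim_lin_span_full => j; have [c c0 Pc] := Paxis j.
  exists (c *+ 2); first by rewrite mulrn_eq0.
  exists (c *: 'e_j), (- (c *: 'e_j)); split=> //; first exact: Psym.
  by rewrite opprK mulr2n scalerDl.
by move=> v0; rewrite PV => /conv_hull_vertex/Vint.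
Qed.

Lemma ehrhart_data_gamma (R : realType) n (P : set 'rV[R]_n) v r :
  ehrhart_data P v r ->
  \prod_i ehrhart_gamma P i = (v^-1)%:C /\ \sum_i ehrhart_gamma P i = r%:C.
Proof.
case=> _ _ _ _ [p [sp p0 pn pn1 pk]].
apply: (@ehrhart_gammaP _ _ _ p) => //.
by apply: ehrhart_eq => k /pk[c /counts_card cc ->]; rewrite -cc.
Qed.

Lemma A_eqP (R : realType) n (P : set 'rV[R]_n) v r :
  ehrhart_data P v r -> r = \sum_(i < n) (succ_min i.+1 P / 2) -> A_eq P.
Proof.
move=> /ehrhart_data_gamma[_ gr] rE.
rewrite /A_eq /arith_mean_gamma /arith_mean_minima gr -rE.
by rewrite [RHS](rmorphM (real_complex R)) /= (fmorphV (real_complex R))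
  (rmorph_nat (real_complex R)).
Qed.

Lemma A_strictP (R : realType) n (P : set 'rV[R]_n) v r : (0 < n)%N ->
  ehrhart_data P v r -> r < \sum_(i < n) (succ_min i.+1 P / 2) -> A_strict P.
Proof.
move=> n0 /ehrhart_data_gamma[_ gr] rE.
rewrite /A_strict /arith_mean_gamma /arith_mean_minima gr.
rewrite [ltRHS](rmorphM (real_complex R)) /= (fmorphV (real_complex R))
  (rmorph_nat (real_complex R)).
by rewrite ltr_pM2l ?ltcR // invr_gt0 ltr0n.
Qed.

Lemma M_lower_eqP (R : realType) n (P : set 'rV[R]_n) v r :
  ehrhart_data P v r -> v^-1 = \prod_(i < n) (succ_min i.+1 P / 2) ->
  M_lower_eq P.
Proof.
move=> /ehrhart_data_gamma[gv _] vE.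
by rewrite /M_lower_eq /geom_mean_gamma /geom_mean_minima gv vE.
Qed.

Lemma rootC_fact (R : realType) n (x : R) :
  n.-root (n`!%:R) * n.-root x%:C = n.-root (n`!%:R * x)%:C :> R[i].
Proof.
rewrite -rootCMl ?ler0n //; congr (_.-root _).
by rewrite [RHS](rmorphM (real_complex R)) /= (rmorph_nat (real_complex R)).
Qed.

Lemma M_upper_eqP (R : realType) n (P : set 'rV[R]_n) v r :
  ehrhart_data P v r ->
  v^-1 = n`!%:R * \prod_(i < n) (succ_min i.+1 P / 2) -> M_upper_eq P.
Proof.
move=> /ehrhart_data_gamma[gv _] vE.
by rewrite /M_upper_eq /geom_mean_gamma /geom_mean_minima gv rootC_fact vE.
Qed.

Lemma M_strictP (R : realType) n (P : set 'rV[R]_n) v r : (0 < n)%N ->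
  ehrhart_data P v r -> 0 <= \prod_(i < n) (succ_min i.+1 P / 2) ->
  \prod_(i < n) (succ_min i.+1 P / 2) < v^-1 ->
  v^-1 < n`!%:R * \prod_(i < n) (succ_min i.+1 P / 2) -> M_strict P.
Proof.
move=> n0 Pd; have v0 := ed_pos Pd; have [gv _] := ehrhart_data_gamma Pd.
move=> prod0 lo up.
have nn (x : R) : 0 <= x -> x%:C \in Num.nneg by rewrite nnegrE ler0c.
rewrite /M_strict /geom_mean_gamma /geom_mean_minima gv rootC_fact.
have vi : 0 <= v^-1 by rewrite invr_ge0 ltW.
by split; rewrite ltr_rootC ?ltcR // nn // mulr_ge0.
Qed.

(** * Bodies whose successive minima are all equal *)

Definition uniform_minima (R : realType) n (P : set 'rV[R]_n) (a : R) :=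
  (forall j, P (a *: 'e_j)) /\
  (forall l x, 0 <= l -> l * a < 1 -> P x -> int_lattice (l *: x) ->
     l *: x = 0).

(** The points [a e_j] put the standard basis into the dilate by [1 / a], while smaller dilates
    contain no nonzero lattice point. *)
Lemma uniform_succ_min (R : realType) n (P : set 'rV[R]_n) a (i : 'I_n) :
  0 < a -> uniform_minima P a -> succ_min i.+1 P = a^-1.
Proof.
move=> a0 [Pe Pmin]; apply: minimum_eq.
  split; first by rewrite invr_gt0.
  rewrite dim_lin_span_full // => j; exists 1; first exact: oner_neq0.
  split; first by exists (a *: 'e_j) => //; rewrite scalerA mulVf ?gt_eqF.
  by move=> j'; rewrite scale1r mxE; apply: natr_int.
move=> l /= [l0 dl]; rewrite leNgt; apply/negP => la.
have : (\dim (lin_span (dilate l P `&` @int_lattice R n)) <=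
        \dim (0%VS : {vspace 'rV[R]_n}))%N.
  apply: dim_lin_span_le => _ [[x Px <-] xint].
  by rewrite (Pmin l x) ?mem0v ?ltW // -ltr_pdivlMr // div1r.
by rewrite dimv0 leqn0 => /eqP d0; rewrite d0 in dl.
Qed.

(** * Splitting off the first coordinate *)

Definition vcons (R : realType) n (t : R) (y : 'rV[R]_n) : 'rV[R]_n.+1 :=
  \row_i oapp (fun j => y 0 j) t (unlift ord0 i).

Definition vtail (R : realType) n (x : 'rV[R]_n.+1) : 'rV[R]_n :=
  \row_j x 0 (lift ord0 j).

Lemma vcons0E (R : realType) n t (y : 'rV[R]_n) : (vcons t y) 0 0 = t.
Proof. by rewrite mxE unlift_none. Qed.

Lemma vconsK (R : realType) n t (y : 'rV[R]_n) : vtail (vcons t y) = y.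
Proof. by apply/rowP => j; rewrite !mxE liftK. Qed.

Lemma vcons_eta (R : realType) n (x : 'rV[R]_n.+1) :
  vcons (x 0 0) (vtail x) = x.
Proof.
by apply/rowP => i; rewrite mxE; case: unliftP => [j|] -> //=; rewrite mxE.
Qed.

Lemma vtailD (R : realType) n (x y : 'rV[R]_n.+1) :
  vtail (x + y) = vtail x + vtail y.
Proof. by apply/rowP => j; rewrite !mxE. Qed.

Lemma vtailZ (R : realType) n l (x : 'rV[R]_n.+1) :
  vtail (l *: x) = l *: vtail x.
Proof. by apply/rowP => j; rewrite !mxE. Qed.

Lemma vtailN (R : realType) n (x : 'rV[R]_n.+1) : vtail (- x) = - vtail x.
Proof. by apply/rowP => j; rewrite !mxE. Qed.

Lemma vtail0 (R : realType) n : vtail (0 : 'rV[R]_n.+1) = 0.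
Proof. by apply/rowP => j; rewrite !mxE. Qed.

Lemma vtail_sum (R : realType) n I (s : seq I) (F : I -> 'rV[R]_n.+1) :
  vtail (\sum_(i <- s) F i) = \sum_(i <- s) vtail (F i).
Proof. exact: (big_morph _ (@vtailD R n) (@vtail0 R n)). Qed.

Lemma vconsD (R : realType) n t s (x y : 'rV[R]_n) :
  vcons (t + s) (x + y) = vcons t x + vcons s y.
Proof.
by apply/rowP => i; rewrite !mxE; case: unliftP => [j|] _ //=; rewrite mxE.
Qed.

Lemma vconsZ (R : realType) n l t (x : 'rV[R]_n) :
  vcons (l * t) (l *: x) = l *: vcons t x.
Proof.
by apply/rowP => i; rewrite !mxE; case: unliftP => [j|] _ //=; rewrite mxE.
Qed.

Lemma vconsN (R : realType) n t (x : 'rV[R]_n) :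
  vcons (- t) (- x) = - vcons t x.
Proof. by rewrite -mulN1r -scaleN1r vconsZ scaleN1r. Qed.

Lemma vcons00 (R : realType) n : vcons 0 (0 : 'rV[R]_n) = 0.
Proof. by rewrite -[0 in LHS](mul0r 0) -(scale0r 0) vconsZ scale0r. Qed.

Lemma vtail_e0 (R : realType) n : vtail ('e_0 : 'rV[R]_n.+1) = 0.
Proof. by apply/rowP => j; rewrite !mxE. Qed.

Lemma vtail_eS (R : realType) n (j : 'I_n) :
  vtail ('e_(lift ord0 j) : 'rV[R]_n.+1) = 'e_j.
Proof. by apply/rowP => i; rewrite !mxE (inj_eq lift_inj). Qed.

Lemma int_lattice_vcons (R : realType) n t (y : 'rV[R]_n) :
  int_lattice (vcons t y) <-> t \is a Num.int /\ int_lattice y.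
Proof.
split=> [h|[ht hy] i].
  split=> [|j]; first by move: (h 0); rewrite vcons0E.
  by move: (h (lift ord0 j)); rewrite mxE liftK.
by rewrite mxE; case: unliftP => [j|] _ /=.
Qed.

(* The two sums run over the nonnegative and the negative heights. *)
Lemma counts_slices (R : realType) n (S : set 'rV[R]_n.+1) m (c : nat -> nat) :
  (forall x, S x -> x 0 0 \is a Num.int /\ `|x 0 0| <= m%:R) ->
  (forall j : int, (`|j| <= m)%N ->
     counts [set y | S (vcons j%:~R y)] (c `|j|%N)) ->
  counts S (\sum_(j < m.+1) c j + \sum_(j < m) c j.+1).
Proof.
move=> Sint Sc.
(* Outside the range of heights the empty list is a dummy value, so that the choice covers all
   integers. *)
have /choice[s sP] : forall j : int, exists s : seq 'rV[R]_n,
    (`|j| <= m)%N -> [/\ uniq s, forall y, S (vcons j%:~R y) <-> y \in s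
                       & size s = c `|j|%N].
  move=> j; case: (boolP (`|j| <= m)%N) => [/Sc[s sP]|_]; last by exists [::].
  by exists s.
(* [Negz j] stands for [-(j + 1)], whence the shifted index in the second sum. *)
pose js := [seq Posz j | j <- iota 0 m.+1] ++ [seq Negz j | j <- iota 0 m].
have jsP j : (j \in js) = (`|j| <= m)%N.
  rewrite mem_cat; case: j => j.
    rewrite mem_map ?mem_iota; last by move=> ? ? [].
    rewrite (_ : (Posz j \in _) = false) ?orbF //.
    by apply/negP => /mapP[].
  rewrite orbC mem_map ?mem_iota; last by move=> ? ? [].
  rewrite (_ : (Negz j \in _) = false) ?orbF //.
  by apply/negP => /mapP[].
have ujs : uniq js.
  rewrite cat_uniq !map_inj_uniq ?iota_uniq ?andbT /=; try by move=> ? ? [].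
  by apply/hasPn => _ /mapP[j _ ->]; apply/negP => /mapP[].
exists [seq vcons j%:~R y | j <- js, y <- s j]; split.
- apply: allpairs_uniq_dep => //.
    by move=> j; rewrite jsP => /sP[].
  move=> [i x] [j y] _ _ /= e.
  have /eqP := congr1 (fun z : 'rV_n.+1 => z 0 0) e; rewrite !vcons0E eqr_int.
  by move=> /eqP ij; move: (congr1 (@vtail R n) e); rewrite !vconsK ij => ->.
- move=> x; split=> [Sx|/allpairsPdep[j [y [jj ys ->]]]]; last first.
    by move: jj ys; rewrite jsP => /sP[_ sj _] /sj.
  have [/intrP[j xj] xm] := Sint _ Sx.
  have jm : (`|j| <= m)%N.
    by move: xm; rewrite xj -intr_norm -[m%:R]/(m%:~R) ler_int -abszE lez_nat.
  apply/allpairsPdep; exists j, (vtail x); rewrite jsP -xj vcons_eta; split=> //.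
  by have [_ <- _] := sP j jm; rewrite -xj vcons_eta.
- have iotaE N (F : nat -> nat) :
      (\sum_(j <- iota 0 N) F j = \sum_(j < N) F j)%N.
    by rewrite -(big_mkord xpredT F) /index_iota subn0.
  rewrite size_allpairs_dep sumnE big_map big_cat !big_map !iotaE.
  have szE (j : int) : (`|j| <= m)%N -> size (s j) = c `|j|%N by move=> /sP[].
  by congr (_ + _)%N; apply: eq_bigr => j _; rewrite szE //= -ltnS ltn_ord.
Qed.

Lemma counts_unit (R : realType) (S : set 'rV[R]_0) : S 0 -> counts S 1.
Proof.
by move=> S0; exists [:: 0]; split=> // x; rewrite !thinmx0 inE eqxx.
Qed.

(** * Prisms *)

Definition prism (R : realType) n (a : R) (P : set 'rV[R]_n) :
    set 'rV[R]_n.+1 :=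
  [set x : 'rV[R]_n.+1 | `|x 0 0| <= a /\ P (vtail x)].

(** If [l x] is a lattice point with [l a < 1], its first coordinate is an integer of absolute value
    below 1, and its tail vanishes by the assumption on the base. *)
Lemma uniform_minima_prism (R : realType) n (a : R) (P : set 'rV[R]_n) :
  0 <= a -> P 0 -> uniform_minima P a -> uniform_minima (prism a P) a.
Proof.
move=> a0 P0 [Pe Pm]; split=> [j|l x l0 la [xa Px] lx].
  split; rewrite ?vtailZ ?mxE.
    rewrite normrM (ger0_norm a0) eqxx /=.
    by case: eqP => _; rewrite ?normr1 ?normr0 ?mulr1 ?mulr0.
  case: (unliftP ord0 j) => [i|] ->; first by rewrite vtail_eS.
  by rewrite vtail_e0 scaler0.
move: lx; rewrite -[l *: x]vcons_eta => /int_lattice_vcons[lx0 lxt].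
rewrite vtailZ in lxt *; rewrite Pm // -vcons00; congr vcons.
have /intrP[z zE] := lx0; rewrite zE.
have : `|(l *: x) 0 0| < 1.
  by rewrite mxE normrM (ger0_norm l0); apply: le_lt_trans la; apply: ler_wpM2l.
rewrite zE -intr_norm -[1]/(1%:~R) ltr_int => z1.
by have -> : z = 0 by lia.
Qed.

(** Each point of the prism lies on the segment joining its projections to the top and bottom
    facets. Conversely, the height is bounded by sublinearity and the tail is linear. *)
Lemma prism_hull (R : realType) n (a : R) (V : seq 'rV[R]_n) : 0 < a ->
  prism a (conv_hull V) =
  conv_hull ([seq vcons a y | y <- V] ++ [seq vcons (- a) y | y <- V]).
Proof.
move=> a0; set W := _ ++ _.
have Wa b y : b = a \/ b = - a -> conv_hull V y -> conv_hull W (vcons b y).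
  move=> hb [w [w0 w1 ->]].
  have -> : vcons b (\sum_i w i *: V`_i) = \sum_i w i *: vcons b V`_i.
    rewrite -[b in LHS]mul1r -[1 in LHS]w1 mulr_suml.
    elim/big_rec3: _ => [|i z x t _ <-]; first by rewrite vcons00.
    by rewrite -vconsZ -vconsD.
  apply: conv_hull_comb => // i; apply: conv_hull_mem.
  by rewrite mem_cat; case: hb => ->; rewrite map_f ?mem_nth ?orbT.
apply/seteqP; split=> x.
  move=> [xa Px].
  (* The weight [t] solves [t a - (1 - t) a = x_0]. *)
  have -> : x = ((x 0 0 + a) / (2 * a)) *: vcons a (vtail x) +
             (1 - (x 0 0 + a) / (2 * a)) *: vcons (- a) (vtail x).
    rewrite -!vconsZ -vconsD -scalerDl [X in X *: _]addrC subrK scale1r.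
    rewrite -[LHS]vcons_eta; congr vcons; field; exact: lt0r_neq0.
  apply: conv_hull_segment; [|apply: Wa; auto..].
  move: xa; rewrite ler_norml => /andP[h1 h2].
  by rewrite ler_pdivrMr ?ler_pdivlMr; nra.
move=> Wx; split.
  apply: (conv_hull_sublinear (f := fun x : 'rV_n.+1 => `|x 0 0|)) Wx.
  - by move=> y z; rewrite mxE ler_normD.
  - by move=> l y l0; rewrite mxE normrM ger0_norm.
  - move=> y; rewrite mem_cat => /orP[] /mapP[z _ ->]; rewrite vcons0E ?normrN;
    by rewrite ger0_norm // ltW.
case: Wx => w [w0 w1 ->]; rewrite vtail_sum.
under eq_bigr => i _ do rewrite vtailZ.
apply: conv_hull_comb => // i; apply: conv_hull_mem.
have : W`_i \in W by apply: mem_nth.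
by rewrite mem_cat => /orP[] /mapP[y Vy ->]; rewrite vconsK.
Qed.

(** The [k]-th dilate has [2 a k + 1] integral slices, each a copy of the [k]-th dilate of the base.
    The polynomial is thus multiplied by [2 a s + 1], which adds the single root [-1 / (2 a)]. *)
Lemma ehrhart_data_prism (R : realType) n (a : nat) (P : set 'rV[R]_n) v r :
  (0 < a)%N -> P 0 -> ehrhart_data P v r ->
  ehrhart_data (prism a%:R P) (2 * a%:R * v) (r + (2 * a%:R)^-1).
Proof.
move=> a0 P0 [[V Vint PV] Psym Pax v0 [p [sp p0 pn pn1 pk]]].
have aR : 0 < a%:R :> R by rewrite ltr0n.
split.
- exists ([seq vcons a%:R y | y <- V] ++ [seq vcons (- a%:R) y | y <- V]).
    move=> x; rewrite mem_cat => /orP[] /mapP[y Vy ->]; apply/int_lattice_vcons;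
    by rewrite ?rpredN; split; [apply: rpred_nat | exact: Vint].
  by rewrite PV prism_hull.
- by move=> x [xa /Psym Px]; split; rewrite ?vtailN // mxE normrN.
- move=> j; case: (unliftP ord0 j) => [i|] ->.
    have [c c0 Pc] := Pax i; exists c => //; split; rewrite ?vtailZ ?vtail_eS //.
    by rewrite !mxE mulr0 normr0 ltW.
  exists a%:R; first by rewrite gt_eqF.
  split; last by rewrite vtailZ vtail_e0 scaler0.
  by rewrite !mxE /= mulr1 normr_nat.
- by rewrite !mulr_gt0.
exists (p * ((2 * a%:R) *: 'X + 1)).
have c0 : 2 * a%:R != 0 :> R by rewrite mulf_neq0 ?gt_eqF.
have sq : size ((2 * a%:R) *: 'X + 1 : {poly R}) = 2%N.
  by rewrite size_polyDl size_scale ?size_polyX ?size_poly1.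
split.
- by rewrite size_mul ?sp ?sq ?addn2 // -size_poly_eq0 ?sp ?sq.
- by rewrite mulrDr -scalerAr mulr1 coefD coefZ coefMX p0 mulr0 add0r.
- rewrite mulrDr -scalerAr mulr1 coefD coefZ coefMX /= pn.
  by rewrite [p`__]nth_default ?sp // addr0.
- rewrite mulrDr -scalerAr mulr1 mulrDr -scalerAr coefD coefZ mulrA coefMX /=.
  rewrite pn1 coefXM /= pn; field; exact: lt0r_neq0.
move=> k k0; have [c cc pc] := pk k k0; exists (c * (2 * a * k + 1))%N; last first.
  by rewrite hornerM pc hornerD hornerZ hornerX hornerC natrM natrD !natrM.
have kR : 0 < k%:R :> R by rewrite ltr0n.
have -> : (c * (2 * a * k + 1) = \sum_(j < (a * k).+1) c + \sum_(j < a * k) c)%N.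
  by rewrite !sum_nat_const !card_ord; lia.
apply: (@counts_slices _ _ _ _ (fun => c)).
  move=> _ [[x [xa Px] <-] xint]; split; first exact: xint.
  by rewrite mxE normrM normr_nat natrM mulrC ler_wpM2r.
move=> j ja; apply: counts_iff cc => y; split.
  move=> [/(dilateE _ _ (lt0r_neq0 kR)) Py yint].
  split; last by apply/int_lattice_vcons; split.
  apply/(dilateE _ _ (lt0r_neq0 kR)); split; last by rewrite vtailZ vconsK.
  rewrite mxE vcons0E normrM normfV normr_nat -intr_norm mulrC ler_pdivrMr //.
  by rewrite -natrM -abszE ler_nat.
move=> [/(dilateE _ _ (lt0r_neq0 kR))[_ Py] /int_lattice_vcons[_ yint]].
rewrite vtailZ vconsK in Py; split=> //.
by apply/(dilateE _ _ (lt0r_neq0 kR)).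
Qed.

Lemma iterated_prism (R : realType) n m (a : nat) (P : set 'rV[R]_n) v r :
  (0 < a)%N -> P 0 -> ehrhart_data P v r -> uniform_minima P a%:R ->
  exists Q : set 'rV[R]_(m + n),
    ehrhart_data Q ((2 * a%:R) ^+ m * v) (r + m%:R / (2 * a%:R)) /\
    uniform_minima Q a%:R.
Proof.
move=> a0 P0 Pd Pu.
(* The induction also carries [Q 0], which the two prism lemmas ask of the base. *)
suff [Q [_ ? ?]] : exists Q : set 'rV[R]_(m + n),
    [/\ Q 0, ehrhart_data Q ((2 * a%:R) ^+ m * v) (r + m%:R / (2 * a%:R)) &
        uniform_minima Q a%:R] by exists Q.
elim: m => [|m [Q [Q0 Qd Qu]]].
  by exists P; rewrite expr0 mul1r mul0r addr0.
exists (prism a%:R Q); split; first by split; rewrite ?vtail0 // mxE normr0.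
  have := ehrhart_data_prism a0 Q0 Qd.
  by rewrite mulrA -exprS -addrA -[X in _ + (_ + X)]mul1r -mulrDl natr1.
exact: uniform_minima_prism.
Qed.

Lemma uniform_sum_minima (R : realType) n (P : set 'rV[R]_n) a :
  0 < a -> uniform_minima P a ->
  \sum_(i < n) (succ_min i.+1 P / 2) = n%:R / (2 * a).
Proof.
move=> a0 Pu; under eq_bigr => i _ do rewrite (uniform_succ_min i a0 Pu).
by rewrite sumr_const card_ord -invfM mulrC mulr_natl.
Qed.

Lemma uniform_prod_minima (R : realType) n (P : set 'rV[R]_n) a :
  0 < a -> uniform_minima P a ->
  \prod_(i < n) (succ_min i.+1 P / 2) = ((2 * a) ^+ n)^-1.
Proof.
move=> a0 Pu; under eq_bigr => i _ do rewrite (uniform_succ_min i a0 Pu).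
by rewrite prodr_const card_ord -invfM mulrC exprVn.
Qed.

(** * Planar polygons *)

Lemma conv_hull_opp (R : realType) n (V : seq 'rV[R]_n) x :
  {in V, forall v, - v \in V} -> conv_hull V x -> conv_hull V (- x).
Proof.
move=> VN [w [w0 w1 ->]]; rewrite -sumrN.
under eq_bigr => i _ do rewrite -scalerN.
by apply: conv_hull_comb => // i; apply/conv_hull_mem/VN/mem_nth.
Qed.

Lemma counts_interval (R : realType) (S : set 'rV[R]_1) (lo : int) N :
  (forall x, S x -> x 0 0 \is a Num.int) ->
  (forall z : int, S (vcons z%:~R 0) <-> lo <= z < lo + N%:Z) -> counts S N.
Proof.
move=> Sint SP; pose f (i : nat) : 'rV[R]_1 := vcons (lo + i%:Z)%:~R 0.
exists [seq f i | i <- iota 0 N]; split; last by rewrite size_map size_iota.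
  rewrite map_inj_uniq ?iota_uniq // => i j /(congr1 (fun x : 'rV_1 => x 0 0)).
  by move=> /eqP; rewrite !vcons0E eqr_int => /eqP; lia.
move=> x; split=> [Sx|]; last first.
  by case/mapP => i; rewrite mem_iota => iN ->; apply/SP; lia.
have /intrP[z zE] := Sint _ Sx.
have xE : x = vcons z%:~R 0.
  by rewrite -[LHS]vcons_eta zE; congr vcons; rewrite thinmx0.
move: Sx; rewrite xE => /SP zb; apply/mapP; exists `|z - lo|%N.
  by rewrite mem_iota; lia.
by rewrite /f; congr (vcons (_%:~R) _); lia.
Qed.

Definition vpair (R : realType) (x y : R) : 'rV[R]_2 := vcons x (vcons y 0).

Lemma vpairP (R : realType) (x : 'rV[R]_2) : x = vpair (x 0 0) (vtail x 0 0).
Proof.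
rewrite -[LHS]vcons_eta; congr vcons; rewrite -[LHS]vcons_eta; congr vcons.
by rewrite thinmx0.
Qed.

Lemma vpair1E (R : realType) (x y : R) : vtail (vpair x y) 0 0 = y.
Proof. by rewrite vconsK vcons0E. Qed.

Lemma vpairN (R : realType) (x y : R) : - vpair x y = vpair (- x) (- y).
Proof. by rewrite /vpair -[0 in RHS]oppr0 !vconsN. Qed.

Lemma vpair_lin (R : realType) (l m x y x' y' : R) :
  l *: vpair x y + m *: vpair x' y' = vpair (l * x + m * x') (l * y + m * y').
Proof.
by rewrite /vpair -!vconsZ -!vconsD !scaler0 addr0.
Qed.

Lemma int_lattice_vpair (R : realType) (x y : R) :
  int_lattice (vpair x y) <-> x \is a Num.int /\ y \is a Num.int.
Proof.
split=> [/int_lattice_vcons[xi /int_lattice_vcons[]]|[xi yi]] //.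
apply/int_lattice_vcons; split=> //; apply/int_lattice_vcons; split=> //.
by case.
Qed.

Lemma vpair_e (R : realType) (j : 'I_2) (c : R) :
  c *: 'e_j = vpair c 0 \/ c *: 'e_j = vpair 0 c.
Proof.
rewrite [c *: _]vpairP !mxE.
by case: j => [[|[|//]] jlt] /=; [left|right]; rewrite ?mulr1 ?mulr0.
Qed.

Lemma conv_hull_vpair_segment (R : realType) (V : seq 'rV[R]_2)
    (x y x1 y1 x2 y2 t : R) :
  0 <= t <= 1 -> x = t * x1 + (1 - t) * x2 -> y = t * y1 + (1 - t) * y2 ->
  conv_hull V (vpair x1 y1) -> conv_hull V (vpair x2 y2) ->
  conv_hull V (vpair x y).
Proof.
by move=> tI -> -> V1 V2; rewrite -vpair_lin; apply: conv_hull_segment.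
Qed.

(** Fills a polygon by vertical segments between its lower and upper boundaries; a segment reduced
    to a point is treated apart, since the weight divides by its length. *)
Lemma conv_hull_vpair_between (R : realType) (V : seq 'rV[R]_2)
    (x y y1 y2 : R) : y1 <= y <= y2 ->
  conv_hull V (vpair x y1) -> conv_hull V (vpair x y2) ->
  conv_hull V (vpair x y).
Proof.
move=> /andP[h1 h2] V1 V2.
have [e|ne] := eqVneq y1 y2.
  by have -> : y = y1 by apply/eqP; rewrite eq_le h1 e h2.
have d0 : 0 < y2 - y1 by rewrite subr_gt0 lt_neqAle ne (le_trans h1).
apply: (conv_hull_vpair_segment (t := (y2 - y) / (y2 - y1))) V1 V2.
- by rewrite ler_pdivlMr // ler_pdivrMr //; lra.
- by ring.
- by field; rewrite gt_eqF.
Qed.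

Lemma quadratic_coefs (R : realType) (v w : R) : v != 0 ->
  let p := Poly [:: 1; w; v] in
  [/\ size p = 3, p`_0 = 1, p`_2 = v, ('X * p)`_2 = w &
      forall x, p.[x] = 1 + w * x + v * x ^+ 2].
Proof.
move=> v0 p; have pE : p = [:: 1; w; v] :> seq R by rewrite (@PolyK _ 1).
rewrite coefXM pE; split=> // x.
by rewrite horner_Poly /=; ring.
Qed.

(** For [c = 2 a - 1] the last inequality cuts the corners [(a, -a)] and [(-a, a)] off the square.
    Keeping [c] free makes the family stable under dilation. *)
Definition hexagon (R : realType) (a c : R) : set 'rV[R]_2 :=
  [set x : 'rV[R]_2 | [/\ `|x 0 0| <= a, `|vtail x 0 0| <= a &
                          `|x 0 0 - vtail x 0 0| <= c]].

Lemma dilate_hexagon (R : realType) (l a c : R) x : 0 < l ->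
  dilate l (hexagon a c) x <-> hexagon (l * a) (l * c) x.
Proof.
move=> l0; rewrite dilateE ?gt_eqF // /hexagon /= vtailZ !mxE -mulrBr.
rewrite !normrM normfV (gtr0_norm l0) ![l^-1 * _]mulrC !ler_pdivrMr //.
by rewrite ![_ * l]mulrC.
Qed.

Definition hexagon_vertices (R : realType) (a : R) : seq 'rV[R]_2 :=
  [:: vpair a a; vpair (1 - a) a; vpair (- a) (a - 1);
      vpair (- a) (- a); vpair (a - 1) (- a); vpair a (1 - a)].

(** A point of the hexagon lies on a vertical segment between the two boundaries; conversely, the
    three defining inequalities are sublinear and hold at the six vertices. *)
Lemma hexagon_hull (R : realType) (a : R) : 1 <= a ->
  hexagon a (2 * a - 1) = conv_hull (hexagon_vertices a).
Proof.
move=> a1; set V := hexagon_vertices a.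
have VN : {in V, forall v, - v \in V}.
  move=> v; rewrite !inE => /or4P[|||/or3P[]] /eqP ->;
  by rewrite vpairN ?opprK ?opprB !eqxx ?orbT.
(* The upper boundary; the lower one follows by symmetry. *)
have up x : `|x| <= a -> conv_hull V (vpair x (Num.min a (x + 2 * a - 1))).
  (* Up to [1 - a] the upper boundary is the edge of slope 1 created by the cut, then it is the top
     edge. Each weight is the relative position of [x] along its edge. *)
  rewrite ler_norml => /andP[h1 h2]; case: (leP x (1 - a)) => h.
    have -> : Num.min a (x + 2 * a - 1) = x + 2 * a - 1.
      by apply/min_idPr; lra.
    apply: (@conv_hull_vpair_segment _ _ _ _ (1 - a) a (- a) (a - 1) (x + a));
      [by apply/andP; split; lra | by ring | by ring |
       by apply: conv_hull_mem; rewrite !inE eqxx ?orbT..].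
  have -> : Num.min a (x + 2 * a - 1) = a by apply/min_idPl; lra.
  have d0 : 0 < 2 * a - 1 by lra.
  apply: (@conv_hull_vpair_segment _ _ _ _ a a (1 - a) a
            ((x - 1 + a) / (2 * a - 1))).
  - by rewrite ler_pdivlMr // ler_pdivrMr //; lra.
  - by field; rewrite gt_eqF.
  - by ring.
  - by apply: conv_hull_mem; rewrite !inE eqxx ?orbT.
  - by apply: conv_hull_mem; rewrite !inE eqxx ?orbT.
apply/seteqP; split=> x.
  move=> [hx hy hxy]; rewrite [x]vpairP.
  move: (x 0 0) (vtail x 0 0) hx hy hxy => {}x y hx hy hxy.
  apply: (@conv_hull_vpair_between _ _ _ _
            (- Num.min a (- x + 2 * a - 1)) (Num.min a (x + 2 * a - 1))).
  - move: hx hy hxy; rewrite !ler_norml => /andP[? ?] /andP[? ?] /andP[? ?].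
    by rewrite lerNl !le_min; apply/andP; split; apply/andP; split; lra.
  - rewrite -[x in vpair x _]opprK -vpairN; apply: conv_hull_opp => //.
    by apply: up; rewrite normrN.
  - exact: up.
move=> Vx; split.
- apply: (conv_hull_sublinear (f := fun x : 'rV_2 => `|x 0 0|)) Vx.
  + by move=> y z; rewrite mxE ler_normD.
  + by move=> l y l0; rewrite mxE normrM ger0_norm.
  + move=> v; rewrite !inE => /or4P[|||/or3P[]] /eqP ->;
    rewrite vcons0E ler_norml;
    by apply/andP; split; lra.
- apply: (conv_hull_sublinear (f := fun x : 'rV_2 => `|vtail x 0 0|)) Vx.
  + by move=> y z; rewrite vtailD mxE ler_normD.
  + by move=> l y l0; rewrite vtailZ mxE normrM ger0_norm.
  + move=> v; rewrite !inE => /or4P[|||/or3P[]] /eqP ->;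
    rewrite vpair1E ler_norml;
    by apply/andP; split; lra.
- apply: (conv_hull_sublinear (f := fun x : 'rV_2 => `|x 0 0 - vtail x 0 0|)) Vx.
  + move=> y z; rewrite vtailD mxE [X in _ - X]mxE opprD addrACA.
    exact: ler_normD.
  + by move=> l y l0; rewrite vtailZ mxE [X in _ - X]mxE -mulrBr normrM ger0_norm.
  + move=> v; rewrite !inE => /or4P[|||/or3P[]] /eqP ->;
    rewrite vpair1E vcons0E ler_norml;
    by apply/andP; split; lra.
Qed.

(** Here [b + k = a k], so [N ^ 2] counts the dilated square. The slices beyond height [b] lose
    [j - b] points, zero below by truncation, and each of the two cut corners removes
    [k (k + 1) / 2] points. *)
Lemma sum_hexagon_slices (b k : nat) (N := (2 * (b + k)).+1) :
  (\sum_(j < (b + k).+1) (N - (j - b)) + \sum_(j < b + k) (N - (j.+1 - b)) =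
   N ^ 2 - k * k.+1)%N.
Proof.
have tri : (2 * \sum_(j < (b + k).+1) (j - b) = k * k.+1)%N.
  elim: k {N} => [|k IH].
    by rewrite big1 // => j _; have := ltn_ord j; lia.
  by rewrite addnS big_ord_recr mulnDr IH /=; lia.
have h : (\sum_(j < (b + k).+1) (N - (j - b)) +
          \sum_(j < (b + k).+1) (j - b) = (b + k).+1 * N)%N.
  rewrite -big_split /= -[in RHS](card_ord (b + k).+1) -sum_nat_const.
  by apply: eq_bigr => j _; have := ltn_ord j; rewrite /N; lia.
(* Removing the term at [j = 0], which equals [N], turns the first sum into the second. *)
have h' := h; rewrite big_ord_recl /= sub0n subn0 in h'.
rewrite -[\sum_(i < b + k) _]/(\sum_(j < b + k) (N - (j.+1 - b)))%N in h'.
have NE : (2 * ((b + k).+1 * N) = N * N + N)%N by rewrite /N; lia.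
rewrite -mulnn; move: h h' tri NE; clearbody N.
move: (\sum_(j < _) (j - b))%N (\sum_(j < _) (N - (j - b)))%N => T A.
move: (\sum_(j < _) _)%N => B; lia.
Qed.

(** The polynomial is [(2 a s + 1) ^ 2 - s (s + 1)]: the square minus its two corners. *)
Lemma hexagon_data (R : realType) (a : nat) : (0 < a)%N ->
  ehrhart_data (hexagon a%:R (2 * a%:R - 1) : set 'rV[R]_2)
    (4 * a%:R ^+ 2 - 1) ((4 * a%:R - 1) / (4 * a%:R ^+ 2 - 1)).
Proof.
move=> a0; have a1 : 1 <= a%:R :> R by rewrite ler1n.
have v0 : 0 < 4 * a%:R ^+ 2 - 1 :> R by nra.
split=> //.
- exists (hexagon_vertices a%:R); last exact: hexagon_hull.
  have aI : (a%:R : R) \is a Num.int by apply: natr_int.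
  move=> v; rewrite !inE => /or4P[|||/or3P[]] /eqP ->; apply/int_lattice_vpair;
  by rewrite ?rpredN ?rpredB ?rpred1.
- move=> x [h1 h2 h3]; split; rewrite ?vtailN mxE ?normrN //.
  by rewrite [X in _ - X]mxE -opprD normrN.
- move=> j; exists 1; first exact: oner_neq0.
  case: (vpair_e j (1 : R)) => ->; split; rewrite ?vpair1E ?vcons0E ler_norml;
  by apply/andP; split; lra.
exists (Poly [:: 1; 4 * a%:R - 1; 4 * a%:R ^+ 2 - 1]).
have [sp p0 p2 p1 pk] := quadratic_coefs (4 * a%:R - 1) (lt0r_neq0 v0).
split=> //; first by rewrite p1 [RHS]mulrC divfK // gt_eqF.
(* In the [k]-th dilate, [b] is the height beyond which the cuts shorten the slices. *)
move=> k k0; pose b := ((a - 1) * k)%N.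
have akE : (a * k = b + k)%N by rewrite /b; case: (a) a0 => // a' _; lia.
exists ((2 * (b + k)).+1 ^ 2 - k * k.+1)%N; last first.
  have sq1 : (k * k.+1 <= (2 * (b + k)).+1 ^ 2)%N.
    by rewrite -mulnn; apply: leq_mul; lia.
  have N1 : (2 * (b + k)).+1%:R = 2 * (a%:R * k%:R) + 1 :> R.
    by rewrite -[(2 * _).+1]addn1 natrD -akE !natrM.
  by rewrite pk natrB // natrX N1 natrM -[k.+1]addn1 natrD; ring.
have kR : 0 < k%:R :> R by rewrite ltr0n.
rewrite -sum_hexagon_slices.
apply: (@counts_slices _ _ _ _ (fun j => (2 * (b + k)).+1 - (j - b))%N).
  move=> x [/(dilate_hexagon _ _ _ kR)[h _ _] xI].
  by split; [exact: xI | rewrite -akE natrM [leRHS]mulrC].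
have akZ : k%:R * a%:R = (b%:Z + k%:Z)%:~R :> R.
  by rewrite -natrM mulnC akE natrD rmorphD.
have ckZ : k%:R * (2 * a%:R - 1) = (2 * b%:Z + k%:Z)%:~R :> R.
  rewrite mulrBr mulrCA akZ mulr1 !rmorphD rmorphM /=; ring.
have hexZ (j z : int) : (dilate k%:R (hexagon a%:R (2 * a%:R - 1)) `&`
       @int_lattice R 2) (vpair j%:~R z%:~R) <->
   [/\ `|j| <= b%:Z + k%:Z, `|z| <= b%:Z + k%:Z & `|j - z| <= 2 * b%:Z + k%:Z].
  have hE : dilate k%:R (hexagon a%:R (2 * a%:R - 1)) (vpair j%:~R z%:~R : 'rV[R]_2)
      <-> [/\ `|j| <= b%:Z + k%:Z, `|z| <= b%:Z + k%:Z & `|j - z| <= 2 * b%:Z + k%:Z].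
    apply: (iff_trans (dilate_hexagon _ _ _ kR)).
    by rewrite /hexagon /= vpair1E vcons0E akZ ckZ -rmorphB -!intr_norm !ler_int.
  split=> [[/hE]|/hE ?] //; split=> //.
  by apply/int_lattice_vpair; split; apply: intr_int.
(* A slice starts at the bottom side or at the cut, whichever is higher. For negative [j] the cut
   shortens the upper end instead, so the length depends only on the absolute value of [j]. *)
move=> j jm; apply: (@counts_interval _ _ (Num.max (- (b + k)%:Z) (j - (2 * b + k)%:Z))).
  by move=> x [_ /int_lattice_vcons[_]]; apply.
move=> z; rewrite -[[set _ | _] _]/(_ (vpair j%:~R z%:~R)).
apply: (iff_trans (hexZ j z)); split; last by move=> h; split; lia.
by case=> h1 h2 h3; lia.
Qed.

Lemma int_norm_lt1 (R : realType) (t : R) :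
  t \is a Num.int -> `|t| < 1 -> t = 0.
Proof.
move=> tI t1; apply/eqP; apply: contraTT t1 => t0.
by rewrite -leNgt norm_intr_ge1.
Qed.

(** The cuts spare the points [a e_j], since [a <= 2 a - 1], so the minima are those of the
    square. *)
Lemma hexagon_minima (R : realType) (a : nat) : (0 < a)%N ->
  uniform_minima (hexagon a%:R (2 * a%:R - 1) : set 'rV[R]_2) a%:R.
Proof.
move=> a0; have a1 : 1 <= a%:R :> R by rewrite ler1n.
split=> [j|l x l0 la [h1 h2 _]].
  case: (vpair_e j (a%:R : R)) => ->; split;
  by rewrite ?vpair1E ?vcons0E ler_norml; apply/andP; split; lra.
rewrite [l *: x]vpairP => /int_lattice_vpair[I1 I2].
have small t : `|t| <= a%:R -> `|l * t| < 1.
  move=> ta; rewrite normrM ger0_norm //.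
  by apply: le_lt_trans la; apply: ler_wpM2l.
have z1 : (l *: x) 0 0 = 0 by apply: int_norm_lt1 => //; rewrite mxE small.
have z2 : vtail (l *: x) 0 0 = 0.
  by apply: int_norm_lt1 => //; rewrite vtailZ mxE small.
by rewrite z1 z2 /vpair !vcons00.
Qed.

(** The image of the square [[-2 l, 2 l] ^ 2] under the shear [y -> y + x / 2], which preserves area
    but not the integer lattice. *)
Definition para (R : realType) (l : R) : set 'rV[R]_2 :=
  [set x : 'rV[R]_2 | `|x 0 0| <= 2 * l /\
                      `|2 * vtail x 0 0 - x 0 0| <= 4 * l].

Lemma dilate_para (R : realType) (l : R) x : 0 < l ->
  dilate l (para 1) x <-> para l x.
Proof.
move=> l0; rewrite dilateE ?gt_eqF // /para /= vtailZ !mxE mulrCA -mulrBr.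
rewrite !normrM normfV (gtr0_norm l0) ![l^-1 * _]mulrC !ler_pdivrMr //.
by rewrite !mulr1.
Qed.

Definition para_vertices (R : realType) : seq 'rV[R]_2 :=
  [:: vpair 2 3; vpair (- 2) 1; vpair (- 2) (- 3); vpair 2 (- 1)].

Lemma para_hull (R : realType) : para 1 = conv_hull (para_vertices R).
Proof.
set V := para_vertices R.
have VN : {in V, forall v, - v \in V}.
  move=> v; rewrite !inE => /or4P[] /eqP ->;
  by rewrite vpairN ?opprK ?opprB !eqxx ?orbT.
(* The upper boundary; the lower one follows by symmetry. *)
have up x : `|x| <= 2 -> conv_hull V (vpair x ((x + 4) / 2)).
  rewrite ler_norml => /andP[h1 h2].
  apply: (@conv_hull_vpair_segment _ _ _ _ 2 3 (- 2) 1 ((x + 2) / 4));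
    [by apply/andP; split; lra | by field | by field |
     by apply: conv_hull_mem; rewrite !inE eqxx ?orbT..].
apply/seteqP; split=> x.
  move=> [hx hxy]; rewrite [x]vpairP.
  move: (x 0 0) (vtail x 0 0) hx hxy => {}x y hx hxy; rewrite mulr1 in hx.
  apply: (@conv_hull_vpair_between _ _ _ _ (- ((- x + 4) / 2)) ((x + 4) / 2)).
  - move: hx hxy; rewrite !ler_norml => /andP[? ?] /andP[? ?].
    by apply/andP; split; lra.
  - rewrite -[x in vpair x _]opprK -vpairN; apply: conv_hull_opp => //.
    by apply: up; rewrite normrN.
  - exact: up.
move=> Vx; split.
- apply: (conv_hull_sublinear (f := fun x : 'rV_2 => `|x 0 0|)) Vx.
  + by move=> y z; rewrite mxE ler_normD.
  + by move=> l y l0; rewrite mxE normrM ger0_norm.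
  + move=> v; rewrite !inE => /or4P[] /eqP ->; rewrite vcons0E ler_norml;
    by apply/andP; split; lra.
- apply: (conv_hull_sublinear
    (f := fun x : 'rV_2 => `|2 * vtail x 0 0 - x 0 0|)) Vx.
  + move=> y z; rewrite vtailD mxE [X in _ - X]mxE mulrDr opprD addrACA.
    exact: ler_normD.
  + move=> l y l0; rewrite vtailZ mxE [X in _ - X]mxE mulrCA -mulrBr normrM.
    by rewrite ger0_norm.
  + move=> v; rewrite !inE => /or4P[] /eqP ->; rewrite vpair1E vcons0E ler_norml;
    by apply/andP; split; lra.
Qed.

(** A vertical slice has length [4 k] and is centred at [j / 2]: it holds [4 k + 1] integers for
    even [j] and one fewer for odd [j]. There are [2 k] odd heights, so the total is
    [(4 k + 1) ^ 2 - 2 k]. *)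
Lemma sum_para_slices k :
  (\sum_(j < (2 * k).+1) ((4 * k).+1 - odd j) +
   \sum_(j < 2 * k) ((4 * k).+1 - odd j.+1) = 16 * k ^ 2 + 6 * k + 1)%N.
Proof.
have odd1 m : (\sum_(j < 2 * m) odd j = m)%N.
  elim: m => [|m IH]; first by rewrite big_ord0.
  by rewrite mulnS 2!big_ord_recr /= IH mul2n /= odd_double; lia.
have odd2 m : (\sum_(j < 2 * m) odd j.+1 = m)%N.
  elim: m => [|m IH]; first by rewrite big_ord0.
  by rewrite mulnS 2!big_ord_recr /= IH mul2n /= odd_double; lia.
have h1 : (\sum_(j < 2 * k) ((4 * k).+1 - odd j) + \sum_(j < 2 * k) odd j =
           2 * k * (4 * k).+1)%N.
  rewrite -big_split /= -[in RHS](card_ord (2 * k)) -sum_nat_const.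
  by apply: eq_bigr => j _; case: odd => /=; lia.
have h2 : (\sum_(j < 2 * k) ((4 * k).+1 - odd j.+1) +
           \sum_(j < 2 * k) odd j.+1 = 2 * k * (4 * k).+1)%N.
  rewrite -big_split /= -[in RHS](card_ord (2 * k)) -sum_nat_const.
  by apply: eq_bigr => j _; case: odd => /=; lia.
rewrite odd1 in h1; rewrite odd2 in h2.
rewrite big_ord_recr /= mul2n odd_double subn0 -mul2n -mulnn.
move: h1 h2; move: (\sum_(j < _) _)%N => A.
by move: (\sum_(j < _) _)%N => B; lia.
Qed.

Lemma para_data (R : realType) :
  ehrhart_data (para 1 : set 'rV[R]_2) 16 (6 / 16).
Proof.
split.
- exists (para_vertices R); last exact: para_hull.
  move=> v; rewrite !inE => /or4P[] /eqP ->; apply/int_lattice_vpair;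
  by rewrite ?rpredN ?rpred_nat ?rpred1.
- move=> x [h1 h2]; split; rewrite ?vtailN mxE ?normrN //.
  by rewrite [X in _ - X]mxE mulrN -opprD normrN.
- move=> j; exists 1; first exact: oner_neq0.
  case: (vpair_e j (1 : R)) => ->; split; rewrite ?vpair1E ?vcons0E ler_norml;
  by apply/andP; split; lra.
- by rewrite ltr0n.
have v0 : 16 != 0 :> R by rewrite pnatr_eq0.
exists (Poly [:: 1; 6; 16]).
have [sp p0 p2 p1 pk] := quadratic_coefs 6 v0.
split=> //; first by rewrite p1 [RHS]mulrC divfK.
move=> k k0; exists (16 * k ^ 2 + 6 * k + 1)%N; last first.
  by rewrite pk !natrD !natrM; ring.
have kR : 0 < k%:R :> R by rewrite ltr0n.
rewrite -sum_para_slices.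
apply: (@counts_slices _ _ _ _ (fun j => (4 * k).+1 - odd j)%N).
  by move=> x [/(dilate_para _ kR)[h _] xI]; split; [exact: xI | rewrite natrM].
have paraZ (j z : int) : (dilate k%:R (para 1) `&` @int_lattice R 2)
     (vpair j%:~R z%:~R) <->
   `|j| <= 2 * k%:Z /\ `|2 * z - j| <= 4 * k%:Z.
  have hE : dilate k%:R (para 1) (vpair j%:~R z%:~R : 'rV[R]_2)
      <-> `|j| <= 2 * k%:Z /\ `|2 * z - j| <= 4 * k%:Z.
    apply: (iff_trans (dilate_para _ kR)).
    rewrite /para /= vpair1E vcons0E.
    have -> : 2 * k%:R = (2 * k%:Z)%:~R :> R by rewrite rmorphM.
    have -> : 4 * k%:R = (4 * k%:Z)%:~R :> R by rewrite rmorphM.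
    have -> : 2 * z%:~R - j%:~R = (2 * z - j)%:~R :> R by rewrite rmorphB rmorphM.
    by rewrite -!intr_norm !ler_int.
  split=> [[/hE]|/hE ?] //; split=> //.
  by apply/int_lattice_vpair; split; apply: intr_int.
move=> j jm.
(* The least integer of the slice: [j / 2] rounded up, minus [2 k]. *)
pose lo : int := ((j + (odd `|j|%N : nat)%:Z) %/ 2)%Z - 2 * k%:Z.
apply: (@counts_interval R _ lo ((4 * k).+1 - odd `|j|%N)).
  by move=> x [_ /int_lattice_vcons[_]]; apply.
move=> z; rewrite -[[set _ | _] _]/(_ (vpair j%:~R z%:~R)).
apply: (iff_trans (paraZ j z)).
rewrite /lo; lia.
Qed.

Lemma para_minima (R : realType) : uniform_minima (para 1 : set 'rV[R]_2) 2%:R.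
Proof.
split=> [j|l x l0 la [h1 h2]].
  case: (vpair_e j (2 : R)) => ->; split;
  by rewrite ?vpair1E ?vcons0E ler_norml; apply/andP; split; lra.
rewrite mulr1 in h1; rewrite mulr1 in h2.
rewrite [l *: x]vpairP => /int_lattice_vpair[I1 I2].
have z1 : (l *: x) 0 0 = 0.
  apply: int_norm_lt1 => //; rewrite mxE normrM ger0_norm //.
  by apply: le_lt_trans la; apply: ler_wpM2l.
have z2 : vtail (l *: x) 0 0 = 0.
  apply: int_norm_lt1 => //.
  (* Once the first coordinate is known to vanish, the sheared inequality bounds the second one
     alone. *)
  have : `|2 * vtail (l *: x) 0 0 - (l *: x) 0 0| < 2.
    rewrite vtailZ mxE [X in _ - X]mxE mulrCA -mulrBr normrM ger0_norm //.
    by apply: (@le_lt_trans _ _ (l * 4)); [apply: ler_wpM2l | lra].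
  by rewrite z1 subr0 normrM (@ger0_norm _ 2) //; lra.
by rewrite z1 z2 /vpair !vcons00.
Qed.

(** * Cross-polytopes *)

Definition l1norm (R : realType) n (x : 'rV[R]_n) : R := \sum_i `|x 0 i|.

Lemma l1normD (R : realType) n (x y : 'rV[R]_n) :
  l1norm (x + y) <= l1norm x + l1norm y.
Proof.
by rewrite -big_split; apply: ler_sum => i _; rewrite mxE ler_normD.
Qed.

Lemma l1normZ (R : realType) n l (x : 'rV[R]_n) :
  0 <= l -> l1norm (l *: x) = l * l1norm x.
Proof.
move=> l0; rewrite /l1norm mulr_sumr; apply: eq_bigr => i _.
by rewrite mxE normrM ger0_norm.
Qed.

Lemma l1norm_ge0 (R : realType) n (x : 'rV[R]_n) : 0 <= l1norm x.
Proof. by apply: sumr_ge0 => i _. Qed.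

Lemma l1norm0 (R : realType) n : l1norm (0 : 'rV[R]_n) = 0.
Proof. by rewrite /l1norm big1 // => i _; rewrite mxE normr0. Qed.

Lemma l1norm_e (R : realType) n (i : 'I_n) : l1norm ('e_i : 'rV[R]_n) = 1.
Proof.
rewrite /l1norm (bigD1 i) //= mxE !eqxx normr1 big1 ?addr0 // => j /negPf ji.
by rewrite mxE eqxx ji normr0.
Qed.

Lemma l1norm_recl (R : realType) n (x : 'rV[R]_n.+1) :
  l1norm x = `|x 0 0| + l1norm (vtail x).
Proof.
by rewrite /l1norm big_ord_recl; congr (_ + _); apply: eq_bigr => i _; rewrite mxE.
Qed.

Lemma l1norm_int (R : realType) n (x : 'rV[R]_n) :
  int_lattice x -> exists s : nat, l1norm x = s%:R.
Proof.
move=> xI; apply/natrP; apply: rpred_sum => i _; apply: natr_norm_int.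
exact: xI.
Qed.

(** The gauge of the cross-polytope with vertices [+-a e_1, +-e_2, ...]; its sublevel set at [k > 0]
    is the dilate by [k]. *)
Definition cross_weight (R : realType) n (a : R) (x : 'rV[R]_n.+1) : R :=
  `|x 0 0| / a + l1norm (vtail x).

Definition cross (R : realType) n (a k : R) : set 'rV[R]_n.+1 :=
  [set x : 'rV[R]_n.+1 | cross_weight a x <= k].

Lemma cross_weightD (R : realType) n (a : R) (x y : 'rV[R]_n.+1) : 0 < a ->
  cross_weight a (x + y) <= cross_weight a x + cross_weight a y.
Proof.
move=> a0; rewrite /cross_weight addrACA -mulrDl vtailD; apply: lerD.
  by rewrite mxE ler_wpM2r ?ler_normD // invr_ge0 ltW.
exact: l1normD.
Qed.

Lemma cross_weightZ (R : realType) n (a l : R) (x : 'rV[R]_n.+1) : 0 <= l ->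
  cross_weight a (l *: x) = l * cross_weight a x.
Proof.
move=> l0; rewrite /cross_weight vtailZ l1normZ // mxE normrM ger0_norm //.
by rewrite mulrDr mulrA.
Qed.

Lemma cross_weightN (R : realType) n (a : R) (x : 'rV[R]_n.+1) :
  cross_weight a (- x) = cross_weight a x.
Proof.
rewrite /cross_weight vtailN mxE normrN; congr (_ + _).
by apply: eq_bigr => i _; rewrite mxE normrN.
Qed.

Lemma cross_weight_e (R : realType) n (a : R) (i : 'I_n.+1) :
  cross_weight a ('e_i : 'rV[R]_n.+1) = if i == ord0 then a^-1 else 1.
Proof.
rewrite /cross_weight; case: (unliftP ord0 i) => [j|] ->.
  by rewrite vtail_eS l1norm_e mxE normr0 mul0r add0r.
by rewrite vtail_e0 l1norm0 mxE /= normr1 mul1r addr0.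
Qed.

Lemma dilate_cross (R : realType) n (a k : R) (x : 'rV[R]_n.+1) : 0 < k ->
  dilate k (cross a 1) x <-> cross a k x.
Proof.
move=> k0; rewrite dilateE ?gt_eqF // /cross /= cross_weightZ; last first.
  by rewrite invr_ge0 ltW.
by rewrite mulrC ler_pdivrMr // mul1r.
Qed.

Definition cross_vertex (R : realType) n (a : R) (i : 'I_n.+1) : 'rV[R]_n.+1 :=
  (if i == ord0 then a else 1) *: 'e_i.

Definition cross_vertices (R : realType) n (a : R) : seq 'rV[R]_n.+1 :=
  [seq cross_vertex a i | i <- enum 'I_n.+1] ++
  [seq - cross_vertex a i | i <- enum 'I_n.+1].

Lemma cross_weight_vertex (R : realType) n (a : R) (i : 'I_n.+1) :
  0 < a -> cross_weight a (cross_vertex a i) = 1.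
Proof.
move=> a0; rewrite /cross_vertex cross_weightZ; last by case: eqP => _ //; rewrite ltW.
by rewrite cross_weight_e; case: eqP => _; rewrite ?mulfV ?mulr1 ?gt_eqF.
Qed.

Lemma cross_hull (R : realType) n (a : R) : 0 < a ->
  cross a 1 = conv_hull (cross_vertices n a).
Proof.
move=> a0; set V := cross_vertices n a.
have Vp i : conv_hull V (cross_vertex a i).
  by apply: conv_hull_mem; rewrite mem_cat map_f ?mem_enum.
have Vn i : conv_hull V (- cross_vertex a i).
  apply: conv_hull_mem; rewrite mem_cat orbC.
  by rewrite (map_f (fun i => - cross_vertex a i)) ?mem_enum.
apply/seteqP; split=> x; last first.
  apply: (conv_hull_sublinear (f := cross_weight a)).
  - by move=> y z; apply: cross_weightD.
  - by move=> l y; apply: cross_weightZ.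
  - by move=> v; rewrite mem_cat => /orP[] /mapP[i _ ->];
      rewrite ?cross_weightN cross_weight_vertex.
pose b (i : 'I_n.+1) : R := if i == ord0 then a else 1.
have b0 i : 0 < b i by rewrite /b; case: eqP.
have wE : cross_weight a x = \sum_i `|x 0 i| / b i.
  rewrite big_ord_recl /cross_weight /b eqxx; congr (_ + _).
  by apply: eq_bigr => i _; rewrite mxE divr1.
rewrite /cross /= => x1.
have V0 : conv_hull V 0.
  have := @conv_hull_segment _ _ V _ _ (1/2) _ (Vp 0) (Vn 0).
  have -> : (1 - 1 / 2 : R) = 1 / 2 by lra.
  by rewrite scalerN subrr; apply; apply/andP; split; lra.
(* Each coordinate uses the vertex of its own sign, and the leftover weight goes to the origin, the
   midpoint of two opposite vertices. *)
have -> : x = \sum_(s : 'I_n.+1 + unit)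
    (match s with inl i => `|x 0 i| / b i | inr _ => 1 - cross_weight a x end) *:
    (match s with inl i => if 0 <= x 0 i then cross_vertex a i
                           else - cross_vertex a i
                | inr _ => 0 end).
  rewrite big_sumType /= [X in _ + X]big1 ?addr0; last by move=> *; rewrite scaler0.
  rewrite [LHS]row_sum_delta; apply: eq_bigr => i _.
  rewrite /cross_vertex -/(b i); case: leP => xi.
    by rewrite ger0_norm // scalerA divfK // gt_eqF.
  by rewrite ltr0_norm // -scaleNr scalerA mulrN !mulNr opprK divfK // gt_eqF.
apply: conv_hull_comb.
- by case=> [i|_]; rewrite ?subr_ge0 // divr_ge0 // ltW.
- by rewrite big_sumType /= -wE big_const card_unit /= addr0 addrC subrK.
- by case=> [i|_] //; case: ifP.
Qed.

(** The Delannoy number counting the integer points of [l1norm] at most [k]: choose [i] nonzero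
    coordinates, their signs, and [i] positive integers of sum at most [k]. *)
Definition cross_count (m k : nat) : nat :=
  (\sum_(i < m.+1) 'C(m, i) * 2 ^ i * 'C(k, i))%N.

Lemma sum_bin k i : (\sum_(r < k) 'C(r, i) = 'C(k, i.+1))%N.
Proof.
by elim: k => [|k IH]; rewrite ?big_ord0 // big_ord_recr /= IH binS.
Qed.

Lemma sum_cross_count m k :
  (\sum_(r < k) cross_count m r =
   \sum_(i < m.+1) 'C(m, i) * 2 ^ i * 'C(k, i.+1))%N.
Proof.
rewrite exchange_big /=; apply: eq_bigr => i _.
by rewrite -big_distrr /= sum_bin.
Qed.

(** Slicing by one coordinate gives a central slice of radius [k] and two slices of each smaller
    radius; algebraically this is Pascal's rule. *)
Lemma cross_countS m k :
  (cross_count m k + 2 * \sum_(r < k) cross_count m r = cross_count m.+1 k)%N.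
Proof.
rewrite sum_cross_count [RHS]/cross_count [RHS]big_ord_recl !bin0 expn0 !mul1n.
under [in RHS]eq_bigr => i _ do rewrite lift0 binS !mulnDl.
rewrite big_split /= addnA; congr (_ + _)%N.
  rewrite [LHS]/cross_count big_ord_recl !bin0 expn0 !mul1n; congr (_ + _)%N.
  by rewrite [RHS]big_ord_recr /= bin_small ?mul0n ?addn0.
by rewrite big_distrr /=; apply: eq_bigr => i _; rewrite expnS; lia.
Qed.

(** The quotient is [(j + 1) / a] rounded up, hence constant on blocks of [a] consecutive heights.
    Reversing the order of the blocks gives the radii [r < k]. *)
Lemma sum_cross_slices (f : nat -> nat) a k : (0 < a)%N ->
  (\sum_(j < a * k) f (k - (j.+1 + a.-1) %/ a) = a * \sum_(r < k) f r)%N.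
Proof.
move=> a0; rewrite -(big_mkord xpredT (fun j => f (k - (j.+1 + a.-1) %/ a)%N)).
rewrite mulnC big_nat_mul big_mkord mulnC big_distrl /=.
rewrite [RHS](reindex_inj rev_ord_inj) /=; apply: eq_bigr => i _.
rewrite (eq_big_nat _ _ (F2 := fun => f (k - i.+1)%N)); last first.
  move=> j /andP[h1 h2]; congr (f (_ - _)%N).
  rewrite (_ : (j.+1 + a.-1) = a + j)%N; last by lia.
  rewrite divnDl ?dvdnn // divnn a0; congr (_.+1).
  by apply/eqP; rewrite eqn_leq -ltnS ltn_divLR // h2 leq_divRL.
by rewrite sum_nat_const_nat mulSn addnK mulnC.
Qed.

(** For integers, [s + j / a <= k] allows [j / a] to be rounded up; the bound on [j] keeps the
    subtraction from being truncated. *)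
Lemma leq_sub_ceil_div a j k s : (0 < a)%N -> (j <= a * k)%N ->
  (s <= k - (j + a.-1) %/ a)%N = (j + s * a <= k * a)%N.
Proof.
move=> a0 jk; set q := ((j + a.-1) %/ a)%N.
have h1 : (q * a <= j + a.-1)%N by apply: leq_trunc_div.
have h2 : (j + a.-1 < q.+1 * a)%N by apply: ltn_ceil.
have qk : (q < k.+1)%N by rewrite -(ltn_pmul2r a0); lia.
apply/idP/idP => h.
  have : ((s + q) * a <= k * a)%N by rewrite leq_mul2r; lia.
  lia.
have : (s + q < k.+1)%N by rewrite -(ltn_pmul2r a0); lia.
lia.
Qed.

(** The slice at height [j] is an [l1norm] ball of radius [k - |j| / a], which may be rounded down
    because the norm is an integer on lattice points. *)
Lemma counts_cross (R : realType) m a k : (0 < a)%N ->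
  (forall r, counts [set y : 'rV[R]_m | int_lattice y /\ l1norm y <= r%:R]
     (cross_count m r)) ->
  counts [set x : 'rV[R]_m.+1 | int_lattice x /\ cross a%:R k%:R x]
    (cross_count m k + 2 * a * \sum_(r < k) cross_count m r).
Proof.
move=> a0 IH; have aR : 0 < a%:R :> R by rewrite ltr0n.
pose c j := cross_count m (k - (j + a.-1) %/ a).
have -> : (cross_count m k + 2 * a * \sum_(r < k) cross_count m r =
  \sum_(j < (a * k).+1) c j + \sum_(j < a * k) c j.+1)%N.
  rewrite [in RHS]big_ord_recl /c.
  under [in RHS]eq_bigr => j _ do rewrite lift0.
  rewrite sum_cross_slices // add0n divn_small ?subn0 ?prednK //; lia.
apply: counts_slices.
  move=> x [xI xk]; split; first exact: xI.
  rewrite natrM mulrC -ler_pdivrMr //; apply: le_trans xk.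
  by rewrite lerDl l1norm_ge0.
move=> j ja; apply: counts_iff (IH _) => y /=.
have key : int_lattice y -> cross a%:R k%:R (vcons j%:~R y) <->
    l1norm y <= (k - (`|j| + a.-1) %/ a)%N%:R.
  move=> /l1norm_int[s sE].
  rewrite /cross /= /cross_weight vconsK vcons0E sE ler_nat.
  rewrite -intr_norm -abszE -[X in X / _]/(`|j|%N%:R) -lerBrDr.
  rewrite ler_pdivrMr // mulrBl lerBrDr -!natrM -natrD ler_nat.
  by rewrite leq_sub_ceil_div.
split=> [[yI yk]|[/int_lattice_vcons[_ yI] yk]]; last by split=> //; apply/key.
by split; [apply/int_lattice_vcons | apply/key].
Qed.

(** Induction on the dimension: the next ball is the cross-polytope with [a = 1]. *)
Lemma counts_l1ball (R : realType) m r :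
  counts [set y : 'rV[R]_m | int_lattice y /\ l1norm y <= r%:R]
    (cross_count m r).
Proof.
elim: m r => [|m IH] r.
  rewrite /cross_count big_ord1 ?bin0 ?expn0 ?bin0; apply: counts_unit.
  by split; [case | rewrite l1norm0].
rewrite -cross_countS -[2%N]muln1; apply: counts_iff (counts_cross r _ IH) => // x.
by rewrite /cross /= /cross_weight divr1 l1norm_recl.
Qed.

(** * Ehrhart polynomials of cross-polytopes in the binomial basis *)

Lemma size_index_enum_ord n : size (index_enum 'I_n) = n.
Proof. by rewrite -[index_enum _]enumT size_enum_ord. Qed.

Definition bin_poly (R : realType) i : {poly R} :=
  (i`!%:R)^-1 *: \prod_(j < i) ('X - (j%:R)%:P).

Lemma horner_bin_poly (R : realType) i k : (bin_poly R i).[k%:R] = 'C(k, i)%:R.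
Proof.
have pE : \prod_(j < i) (k%:R - j%:R : R) = (k ^_ i)%:R.
  elim: i => [|i IH]; first by rewrite big_ord0.
  rewrite big_ord_recr /= IH ffactnSr natrM.
  case: (leqP i k) => [ik|ki]; first by rewrite natrB.
  by rewrite ffact_small // !mul0r.
rewrite hornerZ horner_prod; under eq_bigr => j _ do rewrite hornerXsubC.
rewrite pE -bin_ffact natrM mulrC mulfK //.
by rewrite pnatr_eq0 -lt0n fact_gt0.
Qed.

Lemma size_bin_poly (R : realType) i : size (bin_poly R i) = i.+1.
Proof.
rewrite size_scale ?invr_eq0 ?pnatr_eq0 -?lt0n ?fact_gt0 //.
by rewrite size_prod_XsubC size_index_enum_ord.
Qed.

Lemma bin_poly_lead (R : realType) i : (bin_poly R i)`_i = (i`!%:R)^-1.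
Proof.
have /monicP := monic_prod_XsubC (index_enum 'I_i) xpredT (fun j => j%:R : R).
rewrite lead_coefE size_prod_XsubC size_index_enum_ord /= => h.
by rewrite coefZ [X in _ * X]h mulr1.
Qed.

(** The roots [0, ..., i] sum to ['C(i.+1, 2)]. *)
Lemma bin_poly_sublead (R : realType) i :
  (bin_poly R i.+1)`_i = - 'C(i.+1, 2)%:R / (i.+1)`!%:R.
Proof.
rewrite coefZ mulrC; congr (_ / _).
have := @coefPn_prod_XsubC _ [seq (nat_of_ord j)%:R : R | j <- index_enum 'I_i.+1].
rewrite size_map size_index_enum_ord !big_map => -> //=.
by rewrite -bin2_sum big_mkord natr_sum.
Qed.

Definition cross_poly (R : realType) m (a : R) : {poly R} :=
  \sum_(i < m.+1) ('C(m, i) * 2 ^ i)%:R *: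
    (bin_poly R i + (2 * a) *: bin_poly R i.+1).

Lemma horner_cross_poly (R : realType) m a k :
  (cross_poly m (a%:R : R)).[k%:R] =
  (cross_count m k + 2 * a * \sum_(r < k) cross_count m r)%:R.
Proof.
rewrite horner_sum sum_cross_count natrD natrM natr_sum natr_sum mulr_sumr.
rewrite -big_split; apply: eq_bigr => i _ /=.
by rewrite hornerZ hornerD [X in _ * (_ + X)]hornerZ !horner_bin_poly !natrM; ring.
Qed.

Lemma bin_poly_coef_small (R : realType) i j :
  (i < j)%N -> (bin_poly R i)`_j = 0.
Proof. by move=> ij; rewrite nth_default ?size_bin_poly. Qed.

Lemma coef_cross_poly (R : realType) m (a : R) j :
  (cross_poly m a)`_j = \sum_(i < m.+1) ('C(m, i) * 2 ^ i)%:R *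
    ((bin_poly R i)`_j + 2 * a * (bin_poly R i.+1)`_j).
Proof.
rewrite coef_sum; apply: eq_bigr => i _.
by rewrite coefZ coefD [X in _ * (_ + X)]coefZ.
Qed.

(** Only the summands [i = m] and [i = m + 1] reach the top two coefficients. In the lower of these
    the terms proportional to [a] cancel, leaving [2 ^ (m + 1) / (m + 1)!]. *)
Lemma cross_poly_coefs (R : realType) m a : (0 < a)%N ->
  let p := cross_poly m.+1 (a%:R : R) in
  let v := 2 ^+ m.+2 * a%:R / (m.+2)`!%:R in
  [/\ size p = m.+3, p`_0 = 1, p`_m.+2 = v &
      ('X * p)`_m.+2 = v * (m.+2%:R / (2 * a%:R))].
Proof.
move=> a0 p v; have aR : a%:R != 0 :> R by rewrite pnatr_eq0 -lt0n.
have fR k : k`!%:R != 0 :> R by rewrite pnatr_eq0 -lt0n fact_gt0.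
have small i j : (i.+1 < j)%N ->
    (bin_poly R i)`_j + 2 * a%:R * (bin_poly R i.+1)`_j = 0.
  by move=> ij; rewrite !bin_poly_coef_small ?mulr0 ?addr0 // ltnW.
have sp : (size p <= m.+3)%N.
  apply/leq_sizeP => j mj; rewrite coef_cross_poly big1 // => i _.
  by rewrite small ?mulr0 // (leq_trans _ mj) // !ltnS -ltnS ltn_ord.
have pn : p`_m.+2 = v.
  rewrite coef_cross_poly big_ord_recr /= big1 ?add0r => [|i _]; last first.
    by rewrite small ?mulr0 //= ltnS ltn_ord.
  rewrite bin_poly_coef_small // add0r bin_poly_lead binn mul1n natrX /v.
  have := fR m.+2; move: (m.+2)`!%:R => f f0; rewrite [2 ^+ m.+2]exprSr.
  by field.
have v0 : v != 0.
  apply: mulf_neq0; last by rewrite invr_eq0.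
  by apply: mulf_neq0 => //; apply: expf_neq0; rewrite pnatr_eq0.
split=> //.
- apply/eqP; rewrite eqn_leq sp /= ltnNge; apply/negP => /leq_sizeP/(_ _ (leqnn _)).
  by rewrite pn; apply/eqP.
- rewrite -horner_coef0 -[0]/(0%:R) horner_cross_poly big_ord0 muln0 addn0.
  rewrite /cross_count big_ord_recl !bin0 expn0 big1 //= => i _.
  by rewrite bin0n muln0.
rewrite coefXM /= coef_cross_poly 2!big_ord_recr /= big1 ?add0r => [|i _]; last first.
  by rewrite small ?mulr0 //= ltnS ltn_ord.
rewrite [(bin_poly R m)`__]bin_poly_coef_small // add0r.
rewrite !bin_poly_lead bin_poly_sublead binn mul1n binSn /v.
have b2 : 'C(m.+2, 2)%:R = m.+2%:R * m.+1%:R / 2 :> R.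
  have /(congr1 (fun n => n%:R : R)) := mul_bin_diag m.+2 1.
  by rewrite -pred_Sn bin1 !natrM => ->; field.
have mR : m.+1%:R != 0 :> R by rewrite pnatr_eq0.
have mR1 : m.+1%:R + 1 != 0 :> R by rewrite natr1 pnatr_eq0.
have m2 : m.+2%:R = m.+1%:R + 1 :> R by rewrite natr1.
have f0 := fR m; rewrite b2 [(m.+2)`!]factS [(m.+1)`!]factS !natrM !natrX !exprS m2.
move: (m.+1%:R) (m`!%:R) mR mR1 f0 => x f x0 x1 f0.
by field; rewrite aR x0 f0 x1.
Qed.

Lemma cross_data (R : realType) m a : (0 < a)%N ->
  ehrhart_data (cross a%:R 1 : set 'rV[R]_m.+2)
    (2 ^+ m.+2 * a%:R / (m.+2)`!%:R) (m.+2%:R / (2 * a%:R)).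
Proof.
move=> a0; have aR : 0 < a%:R :> R by rewrite ltr0n.
split.
- exists (cross_vertices m.+1 a%:R); last exact: cross_hull.
  have vI i : int_lattice (cross_vertex a%:R i : 'rV[R]_m.+2).
    move=> j; rewrite !mxE rpredM ?natr_int //.
    by case: (i == ord0); rewrite ?natr_int ?rpred1.
  move=> v; rewrite mem_cat => /orP[] /mapP[i _ ->]; first exact: vI.
  by move=> j; rewrite mxE rpredN; apply: vI.
- by move=> x; rewrite /cross /= cross_weightN.
- move=> j; exists (if j == ord0 then a%:R else 1).
    by case: ifP => _; rewrite ?oner_eq0 ?gt_eqF.
  by rewrite /cross /= -/(cross_vertex a%:R j) cross_weight_vertex.
- by apply: divr_gt0; [apply: mulr_gt0 => //; apply: exprn_gt0; rewrite ltr0n |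
    rewrite ltr0n fact_gt0].
exists (cross_poly m.+1 a%:R).
have [sp p0 pn pn1] := cross_poly_coefs R m a0.
split=> // k k0; eexists; last exact: horner_cross_poly.
apply: counts_iff (counts_cross k a0 (@counts_l1ball R m.+1)) => x /=.
have kR : 0 < k%:R :> R by rewrite ltr0n.
by split=> -[h1 h2]; split=> //; apply/(dilate_cross _ _ kR).
Qed.

(** * Successive minima of cross-polytopes *)

Lemma int_lattice_e (R : realType) n (i : 'I_n) : int_lattice ('e_i : 'rV[R]_n).
Proof. by move=> j; rewrite mxE; apply: natr_int. Qed.

(** Below scale 1 every tail coordinate is an integer of absolute value less than 1, so the lattice
    points left lie on the long axis. *)
Lemma cross_small (R : realType) n (a l : R) (x : 'rV[R]_n.+1) : 0 < a ->
  cross a 1 x -> int_lattice (l *: x) -> 0 <= l < 1 -> l *: x = vcons (l * x 0 0) 0.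
Proof.
move=> a0 x1 xI /andP[l0 l1]; rewrite -[LHS]vcons_eta mxE; congr vcons.
apply/rowP => j; rewrite [RHS]mxE; apply: int_norm_lt1.
  by rewrite mxE; apply: xI.
apply: le_lt_trans l1; rewrite vtailZ mxE normrM ger0_norm //.
rewrite -[leRHS]mulr1; apply: ler_wpM2l => //; apply: le_trans x1.
apply: (@le_trans _ _ (l1norm (vtail x))).
  by rewrite /l1norm (bigD1 j) //= lerDl sumr_ge0.
by rewrite lerDr divr_ge0 // ltW.
Qed.

Lemma cross_succ_min0 (R : realType) n (a : R) : 1 <= a ->
  succ_min 1 (cross a 1 : set 'rV[R]_n.+1) = a^-1.
Proof.
move=> a1; have a0 : 0 < a by apply: lt_le_trans a1.
apply: minimum_eq.
  split; first by rewrite invr_gt0.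
  have e0 : ('e_0 : 'rV[R]_n.+1) \in lin_span (dilate a^-1 (cross a 1) `&` @int_lattice R n.+1).
    apply: (lin_spanP _).1; split; last exact: int_lattice_e.
    apply/dilate_cross; rewrite ?invr_gt0 //.
    by rewrite /cross /= cross_weight_e.
  rewrite lt0n dimv_eq0; apply: contraTneq e0 => ->; rewrite memv0.
  apply/eqP => /rowP/(_ 0)/eqP; rewrite !mxE; exact/negP/oner_neq0.
move=> l [l0 dl]; rewrite leNgt; apply/negP => la.
have l1 : l < 1 by apply: lt_le_trans la _; rewrite invf_le1.
suff : (\dim (lin_span (dilate l (cross a 1) `&` @int_lattice R n.+1)) <=
        \dim (0%VS : {vspace 'rV[R]_n.+1}))%N.
  by rewrite dimv0 leqn0 => /eqP d0; rewrite d0 in dl.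
apply: dim_lin_span_le => _ [[x x1 <-] xI].
rewrite (cross_small a0 x1 xI) ?ltW // memv0 -vcons00.
apply/eqP; congr vcons; apply: int_norm_lt1.
  by have := xI 0; rewrite mxE.
have xa : `|x 0 0| <= a.
  rewrite -[leRHS]mul1r -ler_pdivrMr //; apply: le_trans x1.
  by rewrite lerDl l1norm_ge0.
rewrite normrM gtr0_norm //; apply: (@le_lt_trans _ _ (l * a)).
  by rewrite ler_wpM2l // ltW.
by rewrite -ltr_pdivlMr // div1r.
Qed.

(** Below scale 1 the lattice points span at most the first axis; at scale 1 all the [e_j] appear,
    as [1 / a <= 1]. *)
Lemma cross_succ_minS (R : realType) n (a : R) (i : 'I_n) : 1 <= a ->
  succ_min i.+2 (cross a 1 : set 'rV[R]_n.+1) = 1.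
Proof.
move=> a1; have a0 : 0 < a by apply: lt_le_trans a1.
apply: minimum_eq.
  split; first exact: ltr01.
  rewrite dim_lin_span_full ?ltnS // => j; exists 1; first exact: oner_neq0.
  rewrite scale1r; split; last exact: int_lattice_e.
  apply/dilate_cross; rewrite ?ltr01 // /cross /= cross_weight_e.
  by case: eqP => // _; rewrite invf_le1.
move=> l [l0 dl]; rewrite leNgt; apply/negP => l1.
suff : (\dim (lin_span (dilate l (cross a 1) `&` @int_lattice R n.+1)) <=
        \dim <['e_ord0 : 'rV[R]_n.+1]>)%N.
  by move=> /(leq_trans dl); rewrite dim_vline; case: (_ == _).
apply: dim_lin_span_le => _ [[x x1 <-] xI].
rewrite (cross_small a0 x1 xI) ?ltW //; apply/vlineP; exists (l * x 0 0).
rewrite -[RHS]vcons_eta vtailZ vtail_e0 scaler0; congr vcons.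
by rewrite !mxE mulr1.
Qed.

Lemma cross_sum_minima (R : realType) n (a : R) : 1 <= a ->
  \sum_(i < n.+1) (succ_min i.+1 (cross a 1 : set 'rV[R]_n.+1) / 2) =
  (a^-1 + n%:R) / 2.
Proof.
move=> a1; rewrite big_ord_recl cross_succ_min0 //.
under eq_bigr => i _ do rewrite lift0 cross_succ_minS //.
by rewrite sumr_const card_ord mulrDl -[_ *+ n]mulr_natl mul1r.
Qed.

Lemma cross_prod_minima (R : realType) n (a : R) : 1 <= a ->
  \prod_(i < n.+1) (succ_min i.+1 (cross a 1 : set 'rV[R]_n.+1) / 2) =
  (a * 2 ^+ n.+1)^-1.
Proof.
move=> a1; rewrite big_ord_recl cross_succ_min0 //.
under eq_bigr => i _ do rewrite lift0 cross_succ_minS //.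
by rewrite prodr_const card_ord exprS !invfM mulrA div1r exprVn.
Qed.

Lemma cross_M_upper_eq (R : realType) m a : (0 < a)%N ->
  M_upper_eq (cross a%:R 1 : set 'rV[R]_m.+2).
Proof.
move=> a0; apply: M_upper_eqP (cross_data R m a0) _.
by rewrite cross_prod_minima ?ler1n // invf_div [2 ^+ _ * _]mulrC.
Qed.

(** * The examples in every dimension at least two *)

Lemma two_le_fact m : (2 <= (m.+2)`!)%N.
Proof. by rewrite (@leq_trans m.+2) // ; apply: fact_geq. Qed.

(** The point is the base from which iterated prisms build the cube. *)
Lemma point_data (R : realType) : ehrhart_data ([set: 'rV[R]_0]) 1 0.
Proof.
split=> //.
- exists [:: 0]; first by move=> x _ [].
  apply/seteqP; split=> // x _; apply: conv_hull_mem.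
  by rewrite !thinmx0 inE eqxx.
- by case.
- exists 1; rewrite size_poly1 coefXM coefC mulr0; split=> // k k0.
  exists 1%N; last by rewrite hornerC.
  by apply: counts_unit; split; [exists 0; rewrite ?scaler0 | case].
Qed.

Lemma point_minima (R : realType) (a : R) : uniform_minima [set: 'rV[R]_0] a.
Proof. by split=> [[]|l x _ _ _ _] //; rewrite thinmx0. Qed.

Lemma box_exists (R : realType) n : exists P : set 'rV[R]_n,
  ehrhart_data P (2 ^+ n) (n%:R / 2) /\ uniform_minima P 1.
Proof.
have := iterated_prism n (ltn0Sn 0) I (point_data R) (point_minima 1).
by rewrite addn0 !mulr1 add0r.
Qed.

Lemma polygon_prism_exists (R : realType) m (a : nat) (P : set 'rV[R]_2) v r :
  (0 < a)%N -> P 0 -> ehrhart_data P v r -> uniform_minima P a%:R ->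
  exists Q : set 'rV[R]_m.+2,
    ehrhart_data Q ((2 * a%:R) ^+ m * v) (r + m%:R / (2 * a%:R)) /\
    uniform_minima Q a%:R.
Proof.
by move=> a0 P0 Pd Pu; have := iterated_prism m a0 P0 Pd Pu; rewrite addn2.
Qed.

Lemma hexagon_prism_exists (R : realType) m (a : nat) : (0 < a)%N ->
  exists Q : set 'rV[R]_m.+2,
    [/\ ehrhart_data Q ((2 * a%:R) ^+ m * (4 * a%:R ^+ 2 - 1))
          ((4 * a%:R - 1) / (4 * a%:R ^+ 2 - 1) + m%:R / (2 * a%:R)),
        uniform_minima Q a%:R & M_strict Q].
Proof.
move=> a0; have a1 : 1 <= a%:R :> R by rewrite ler1n.
have H0 : (hexagon a%:R (2 * a%:R - 1) : set 'rV[R]_2) 0.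
  by split; rewrite ?vtail0 !mxE ?subr0 normr0; lra.
have [Q [Qd Qu]] := polygon_prism_exists m a0 H0 (hexagon_data R a0) (hexagon_minima R a0).
exists Q; split=> //.
have aR : 0 < a%:R :> R by rewrite ltr0n.
have c0 : 0 < (2 * a%:R) ^+ m :> R by rewrite exprn_gt0 // mulr_gt0.
have w0 : 0 < 4 * a%:R ^+ 2 - 1 :> R by nra.
have W0 : 0 < 4 * a%:R ^+ 2 :> R by lra.
have cE : (2 * a%:R) ^+ m.+2 = (2 * a%:R) ^+ m * (4 * a%:R ^+ 2) :> R.
  by rewrite !exprS; ring.
apply: (M_strictP _ Qd) => //; rewrite (uniform_prod_minima aR Qu) cE.
- by rewrite invr_ge0; apply/mulr_ge0; apply: ltW.
- by rewrite ltf_pV2 ?posrE ?(mulr_gt0 c0) // ltr_pM2l //; lra.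
have f2 : 2 <= (m.+2)`!%:R :> R by rewrite ler_nat two_le_fact.
(* Follows from [n! >= 2] and [8 a ^ 2 - 2 > 4 a ^ 2], valid for [a >= 1]. *)
have fw : 4 * a%:R ^+ 2 < (m.+2)`!%:R * (4 * a%:R ^+ 2 - 1) :> R by nra.
rewrite ltr_pdivlMr ?(mulr_gt0 c0) // mulrC ltr_pdivrMr ?(mulr_gt0 c0) //.
by rewrite [ltRHS]mulrCA ltr_pM2l.
Qed.

Theorem proposition1p3 (R : realType) (n : nat) (hn : (1 < n)%N) :
  [/\ exists P : set 'rV[R]_n,
        [/\ symmetric_lattice_polytope P, A_eq P & M_upper_eq P],
      exists P : set 'rV[R]_n,
        [/\ symmetric_lattice_polytope P, A_eq P & M_lower_eq P] &
      exists P : set 'rV[R]_n,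
        [/\ symmetric_lattice_polytope P, A_eq P & M_strict P]] /\
  [/\ exists P : set 'rV[R]_n,
        [/\ symmetric_lattice_polytope P, A_strict P & M_upper_eq P],
      exists P : set 'rV[R]_n,
        [/\ symmetric_lattice_polytope P, A_strict P & M_lower_eq P] &
      exists P : set 'rV[R]_n,
        [/\ symmetric_lattice_polytope P, A_strict P & M_strict P]].
Proof.
case: n hn => [|[|m]] // _.
have m1 : m.+1%:R = m%:R + 1 :> R by rewrite natr1.
have m2 : m.+2%:R = m%:R + 2 :> R by rewrite -addn2 natrD.
have m0 := ler0n R m; split; split.
- have Pd := cross_data R m (ltn0Sn 0).
  exists (cross 1%:R 1); split; first exact: ehrhart_data_symmetric Pd.
    apply: (A_eqP Pd); rewrite cross_sum_minima // mulr1 invr1.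
    by rewrite m1 m2; field.
  exact: cross_M_upper_eq.
- have [Q [Qd Qu]] := box_exists R m.+2.
  exists Q; split; first exact: ehrhart_data_symmetric Qd.
    by apply: (A_eqP Qd); rewrite (uniform_sum_minima ltr01 Qu) mulr1.
  by apply: (M_lower_eqP Qd); rewrite (uniform_prod_minima ltr01 Qu) mulr1.
(* For [a = 1] the hexagon contributes [3 / 3 = 1], exactly as the square does. *)
- have [Q [Qd Qu Qs]] := hexagon_prism_exists R m (ltn0Sn 0).
  exists Q; split=> //; first exact: ehrhart_data_symmetric Qd.
  apply: (A_eqP Qd); rewrite (uniform_sum_minima ltr01 Qu).
  by rewrite m2; field.
(* With [a = 2], (A) compares [(m + 2) / 4] with [(2 m + 3) / 4]. *)
- have Pd := cross_data R m (ltn0Sn 1).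
  exists (cross 2%:R 1); split; first exact: ehrhart_data_symmetric Pd.
    apply: (A_strictP _ Pd) => //; rewrite cross_sum_minima ?ler1n //.
    by rewrite ?m1 m2; lra.
  exact: cross_M_upper_eq.
(* Volume 16 matches two minima [1 / 2], while [6 / 16 < 1 / 2] makes (A) strict. *)
- have P0 : (para 1 : set 'rV[R]_2) 0.
    by split; rewrite ?vtail0 !mxE ?mulr0 ?subr0 normr0; lra.
  have [Q [Qd Qu]] := polygon_prism_exists m (ltn0Sn 1) P0 (para_data R) (para_minima R).
  have two : 0 < 2%:R :> R by rewrite ltr0n.
  exists Q; split; first exact: ehrhart_data_symmetric Qd.
    apply: (A_strictP _ Qd) => //; rewrite (uniform_sum_minima two Qu).
    by rewrite ?m1 m2; lra.
  apply: (M_lower_eqP Qd); rewrite (uniform_prod_minima two Qu) !exprS.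
  by congr (_^-1); ring.
(* For [a = 2] the hexagon contributes [7 / 15], less than the [1 / 2] of the minima. *)
- have [Q [Qd Qu Qs]] := hexagon_prism_exists R m (ltn0Sn 1).
  have two : 0 < 2%:R :> R by rewrite ltr0n.
  exists Q; split=> //; first exact: ehrhart_data_symmetric Qd.
  apply: (A_strictP _ Qd) => //; rewrite (uniform_sum_minima two Qu).
  have -> : (4 * 2 - 1) / (4 * 2 ^+ 2 - 1) = 7 / 15 :> R by congr (_ / _); ring.
  by rewrite m2; lra.
Qed.
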